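(* Let $V=\{1,\dots,n\}$ and $\mathcal{H}=\bigotimes_{v\in V}\mathcal{H}^v$ with $\dim\mathcal{H}^v=d$. Let $k\ge 1$ and $g>0$. Let $H=\sum_{X\subseteq V,\,|X|\le k} h_X$, where each $h_X$ is a Hermitian operator on $\mathcal{H}$ supported on $X$, with $\sum_{X:X\ni v}\|h_X\|\le g$ for all $v\in V$. Let $\mathcal{F}=\sum_{X\subseteq V,\,|X|\le k} f_X$, where each $f_X$ is a Hermitian operator supported on $X$, with $\sum_{X:X\ni v}\|f_X\|\le g$ for all $v\in V$, and set $\bar{\mathcal{F}}:=\sum_{|X|\le k}\|f_X\|$. Let $\beta\ge 0$, $\rho=e^{-\beta H}/Z$ with $Z=\mathrm{tr}(e^{-\beta H})$, and $\langle\mathcal{F}\rangle_\beta:=\mathrm{tr}(\mathcal{F}\rho)$. If $$\beta<\beta_c:=\frac{1}{8e^3gk},$$ then for every real $\tau$ with $|\tau|<\beta_c-\beta$, $$\log\big[\mathrm{tr}(e^{-\tau\mathcal{F}}\rho)\big]\le -\tau\langle\mathcal{F}\rangle_\beta+\frac{\tau^2\bar{\mathcal{F}}}{\beta_c-\beta-|\tau|}.$$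
   Context: $\|\cdot\|$ is the operator norm. An operator ''supported on $X$'' acts as the identity on $\bigotimes_{v\notin X}\mathcal{H}^v$. The sums $\sum_{X:X\ni v}$ run over all subsets $X\subseteq V$ with $|X|\le k$ containing $v$. *)

(* Defs.v *)
From mathcomp Require Import all_boot all_order all_algebra all_classical all_reals all_analysis.
From mathcomp Require Import complex.
Import numFieldNormedType.Exports.
Set Implicit Arguments. Unset Strict Implicit. Unset Printing Implicit Defensive.
Import Order.TTheory GRing.Theory Num.Theory.
Local Open Scope ring_scope.
Local Open Scope classical_set_scope.

(* Basis configurations of the n-site system with local dimension d:
   the computational basis of (C^d)^{(x) n} is indexed by functions 'I_n -> 'I_d. *)
Definition cfg (n d : nat) := {ffun 'I_n -> 'I_d}.
Definition hdim (n d : nat) : nat := #|{: cfg n d}|.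
Definition qop (R : realType) (n d : nat) := 'M[R[i]]_(hdim n d).

Definition melt (R : realType) n d (A : qop R n d) (s t : cfg n d) : R[i] :=
  A (enum_rank s) (enum_rank t).

(* A is supported on X : A = a_X (x) Id_{V \ X}, written out on basis elements *)
Definition supported_on (R : realType) n d (X : {set 'I_n}) (A : qop R n d) : Prop :=
  (forall s t : cfg n d, (exists v, v \notin X /\ s v <> t v) -> melt A s t = 0) /\
  (forall s t s' t' : cfg n d,
      (forall v, v \in X -> s v = s' v /\ t v = t' v) ->
      (forall v, v \notin X -> s v = t v) ->
      (forall v, v \notin X -> s' v = t' v) ->
      melt A s t = melt A s' t').

Definition is_hermitian_op (R : realType) m (A : 'M[R[i]]_m) : Prop :=
  A = map_mx (@conjc R) A^T.

Definition vnorm (R : realType) m (v : 'cV[R[i]]_m) : R :=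
  Num.sqrt (\sum_i (Normc.normc (v i ord0)) ^+ 2).

Definition opnorm (R : realType) m (A : 'M[R[i]]_m) : R :=
  sup [set vnorm (A *m v) | v in [set v : 'cV[R[i]]_m | vnorm v = 1]].

Definition mexp (R : realType) m (A : 'M[R[i]]_m) : 'M[R[i]]_m :=
  lim ((series (fun k : nat => ((k`!)%:R^-1 *: A ^+ k : 'M[(R[i] : numFieldType)]_m))) @ \oo).

Definition betac (R : realType) (g : R) (k : nat) : R :=
  (8 * expR 1 ^+ 3 * g * k%:R)^-1.

(* Main.v *)
(* Diagonalising F and H turns Z(s) = tr (e^{-sF} e^{-beta H}) into a sum of real
   exponentials sum_j p_j e^{-s a_j} with p_j >= 0, so by Taylor's formula it is
   enough to bound (log Z)'' uniformly on |s| <= |tau|.  Now (log Z)'' Z^2 is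
   Z'' Z - Z'^2 = sum_{X,Y} D(f_X, f_Y), where, with G = e^{-sF} e^{-beta H},
   D(P, Q) = tr(P Q G) tr(G) - tr(P G) tr(Q G), and
   sum_Y |D(f_X, f_Y)| <= 16 g k ||f_X|| tr(G)^2 at high temperature.

   For the last bound, view tr(P G) as a function Z_P of the set E of interaction
   terms ("bonds") that are switched on.  Two facts are used: Z_{PQ} factorises
   when the supports of P, E1 and of Q, E2 are separated, and the weight of the
   terms in which every bond of C occurs is at most
   ||P|| prod_{X in C} (e^{t_X} - 1), t_X = |s| ||f_X|| + beta ||h_X||.
   Starting from the support of P, one decides for one adjacent bond at a time
   whether it occurs, until no bond touches the explored region; there the
   partition function of the remaining bonds factors out.  Induction on the number
   of bonds controls the ratios of partition functions on the way.  For
   D(P, Q) the exploration is done in both factors at once, and the two products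
   cancel exactly if the explored region ends up disjoint from the support of Q. *)
Require Import Defs.
From mathcomp Require Import all_boot all_order all_algebra all_classical all_reals all_analysis.
From mathcomp Require Import complex.
From mathcomp Require Import perm ring lra.
Import numFieldNormedType.Exports.
Import Order.TTheory GRing.Theory Num.Theory.
Set Implicit Arguments. Unset Strict Implicit. Unset Printing Implicit Defensive.
Local Open Scope ring_scope.

(** * Cluster expansion *)

Section AlternatingSums.
Context (I : finType).
Implicit Types (A C E : {set I}) (X : I).

Lemma big_subsetU1 (V : nmodType) X C (F : {set I} -> V) : X \notin C ->
  \sum_(A : {set I} | A \subset X |: C) F A =
    \sum_(A : {set I} | A \subset C) F A + \sum_(A : {set I} | A \subset C) F (X |: A).
Proof.
move=> XC; rewrite (bigID (fun A : {set I} => X \in A)) /= addrC; congr (_ + _).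
  apply: eq_bigl => A; apply/andP/idP => [[AXC XA]|AC].
    by rewrite -(finset.setU1K XC) finset.subsetD1 AXC XA.
  split; first by apply: fintype.subset_trans AC _; exact: finset.subsetUr.
  by apply: contra XC => /(fintype.subsetP AC).
rewrite (reindex_onto (fun A => X |: A) (fun A => A :\ X)) /=; last first.
  by move=> A /andP[_ XA]; exact: finset.setD1K.
apply: eq_bigl => A; apply/idP/idP => [/andP[/andP[AXC _] /eqP AX]|AC].
  have XA : X \notin A by rewrite -AX !inE eqxx.
  apply/fintype.subsetP => Y YA; move/fintype.subsetP: AXC => /(_ Y).
  rewrite !inE YA orbT => /(_ isT).
  by case/orP => [/eqP YX|//]; rewrite -YX YA in XA.
have XA : X \notin A by apply: contra XC => /(fintype.subsetP AC).
by rewrite finset.setUS //= finset.setU11 finset.setU1K // eqxx.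
Qed.

(* Inclusion-exclusion: when [Z A] is the sum of weights [w B] over [B \subset A],
   this is the sum of [w (C :|: B)] over [B \subset E] (see [altsum_mobius]). *)
Definition altsum (W : pzRingType) (Z : {set I} -> W) C E : W :=
  \sum_(A : {set I} | A \subset C) (-1) ^+ #|C :\: A| * Z (A :|: E).

(** Among the subsets of [X |: C], those without [X] contribute [- altsum Z C E] and those with [X]
    contribute [altsum Z C (X |: E)]. This is one step of the exploration: either [X] does not
    occur, or it joins the bonds [C] known to occur. *)
Lemma altsum_setU1 (W : pzRingType) (Z : {set I} -> W) C E X : X \notin C ->
  altsum Z C (X |: E) = altsum Z C E + altsum Z (X |: C) E.
Proof.
move=> XC; rewrite /altsum big_subsetU1 // addrA.
rewrite -[LHS]add0r; congr (_ + _).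
  apply/esym; rewrite -big_split /= big1 // => A AC.
  have XA : X \notin A by apply: contra XC => /(fintype.subsetP AC).
  have -> : (X |: C) :\: A = X |: (C :\: A).
    by apply/setP => Y; rewrite !inE; case: eqP => [->|//]; rewrite XA.
  by rewrite cardsU1 !inE XA (negbTE XC) add1n exprS mulN1r mulNr subrr.
apply: eq_bigr => A AC; rewrite finset.setUCA finset.setUA; congr ((-1) ^+ #|pred_of_set _| * _).
  apply/setP => Y; rewrite !inE; case: eqP => [->|//].
  by rewrite (negbTE XC) andbF.
Qed.

Lemma altsum0 (W : pzRingType) (Z : {set I} -> W) E : altsum Z finset.set0 E = Z E.
Proof.
rewrite /altsum (eq_bigl (pred1 finset.set0)); last first.
  by move=> D; rewrite finset.subset0.
by rewrite big_pred1_eq finset.setD0 cards0 expr0 mul1r finset.set0U.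
Qed.

End AlternatingSums.

(** * Modulus of complex numbers *)

Section NormcTheory.
Context (R : realType).
Implicit Types (x y : R[i]).
Local Notation normc := (@Normc.normc R).

Lemma normc_ge0 x : 0 <= normc x.
Proof. by case: x => a b; exact: sqrtr_ge0. Qed.

Lemma ler_normcB x y : normc (x - y) <= normc x + normc y.
Proof. by rewrite -(normcN y); exact: le_normcD. Qed.

Lemma ler_normc_sum (J : Type) (r : seq J) (P : pred J) (F : J -> R[i]) :
  normc (\sum_(i <- r | P i) F i) <= \sum_(i <- r | P i) normc (F i).
Proof.
elim/big_rec2: _ => [|i y x _ le_xy]; first by rewrite Normc.normc0.
by apply: le_trans (le_normcD _ _) _; rewrite lerD2l.
Qed.

Lemma normc_real (a : R) : normc (real_complex R a) = `|a|.
Proof. by rewrite /= expr0n /= addr0 sqrtr_sqr. Qed.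

End NormcTheory.

(** * Explored regions and the weight of their extensions *)

Section ClusterExpansion.
Context (R : realType) (T : finType).
Local Notation normc := (@Normc.normc R).
Local Notation bonds := {set {set T}}.
Implicit Types (C E : bonds) (S X : {set T}).

Definition away S E : bonds := [set X in E | [disjoint X & S]].

Lemma away_sub S E : away S E \subset E.
Proof. by apply/fintype.subsetP => X; rewrite inE => /andP[]. Qed.

Lemma disjointsU (J : finType) (A B D : {set J}) :
  [disjoint A :|: B & D] = [disjoint A & D] && [disjoint B & D].
Proof. by rewrite -!setI_eq0 finset.setIUl finset.setU_eq0. Qed.

Lemma disjoint_away S E : [disjoint S & finset.cover (away S E)].
Proof.
apply/finset.bigcup_disjointP => X.
by rewrite inE => /andP[_]; rewrite disjoint_sym.
Qed.

Lemma awayU S X E : away (S :|: X) E = away X (away S E).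
Proof.
apply/setP => Y; rewrite !inE -andbA; congr (_ && _).
by rewrite disjoint_sym disjointsU ![[disjoint _ & Y]]disjoint_sym.
Qed.

Context (x : {set T} -> R) (K : R).
Hypotheses (x_ge0 : forall X, 0 <= x X) (K_ge0 : 0 <= K).

(** Majorant for the ways to extend the region [S]: each bond touching [S] is absent (the 1) or
    present with weight [x X], and [K ^+ #|X|] pays for the sites it adds. *)
Definition growth S E : R := \prod_(X in E | ~~ [disjoint X & S]) (1 + x X * K ^+ #|X|).

Lemma bond_factor_ge1 X : 1 <= 1 + x X * K ^+ #|X|.
Proof. by rewrite lerDl mulr_ge0 ?exprn_ge0. Qed.

Lemma growth_ge1 S E : 1 <= growth S E.
Proof.
rewrite /growth; elim/big_rec: _ => // X y _ y_ge1.
by rewrite mulr_ege1 ?bond_factor_ge1.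
Qed.

Lemma growth_set1 E X S : X \in E -> ~~ [disjoint X & S] ->
  growth S E = (1 + x X * K ^+ #|X|) * growth S (E :\ X).
Proof.
move=> XE XS; rewrite /growth (bigD1 X) ?XE //=; congr (_ * _).
by apply: eq_bigl => Y; rewrite !inE andbAC [(Y != X) && _]andbC.
Qed.

Lemma growthU S X E : growth (S :|: X) E <= growth S E * growth X E.
Proof.
rewrite /growth ![\prod_(Y in E | _) _]big_mkcondr -big_split /=.
apply: ler_prod => Y YE; rewrite [[disjoint Y & S :|: X]]disjoint_sym disjointsU.
rewrite ![[disjoint _ & Y]]disjoint_sym.
have g1 := bond_factor_ge1 Y; have g0 := le_trans ler01 g1.
case: [disjoint Y & S]; case: [disjoint Y & X];
  rewrite /= ?mul1r ?mulr1 ?lexx ?ler01 ?g0 //=.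
by rewrite -{1}[1 + _]mulr1 ler_wpM2l.
Qed.

Context (B : R).
(** Convergence criterion of the expansion: a bound per site, uniform in the bonds still
    available. *)
Hypothesis growth_vertex : forall v E, growth [set v] E <= B.

Lemma set_ind_setU1 (P : {set T} -> Prop) :
  P finset.set0 -> (forall v S, v \notin S -> P S -> P (v |: S)) -> forall S, P S.
Proof.
move=> P0 PU S; have [n le_n] := ubnP #|S|; elim: n => // n IH in S le_n *.
have [->//|/finset.set0Pn[v vS]] := eqVneq S finset.set0.
rewrite -(finset.setD1K vS); apply: PU; first by rewrite !inE eqxx.
by apply: IH; move: le_n; rewrite (cardsD1 v S) vS.
Qed.

Lemma growth_le S E : growth S E <= B ^+ #|S|.
Proof.
elim/set_ind_setU1: S => [|v S vS IH].
  rewrite cards0 expr0 /growth big1 // => X /andP[_].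
  by rewrite -setI_eq0 finset.setI0 eqxx.
rewrite cardsU1 vS exprS finset.setUC mulrC.
apply: le_trans (growthU _ _ _) _.
by apply: ler_pM => //; exact: le_trans ler01 (growth_ge1 _ _).
Qed.

Lemma growthU_le S X E : growth (S :|: X) E <= growth S E * B ^+ #|X|.
Proof.
apply: le_trans (growthU _ _ _) _; rewrite ler_wpM2l ?growth_le //.
exact: le_trans ler01 (growth_ge1 _ _).
Qed.

(* [Z] is the expectation functional of a local operator supported on [S]:
   what lies away from [S] factors out as the partition function [Z0]. *)
Definition local_observable (Z0 Z : bonds -> R[i]) S (c : R) : Prop :=
  (forall E1 E2, [disjoint E1 & E2] -> [disjoint S :|: finset.cover E1 & finset.cover E2] ->
     Z (E1 :|: E2) = Z E1 * Z0 E2) /\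
  (forall C, normc (altsum Z C finset.set0) <= c * \prod_(X in C) x X).

(** [S] and all bonds of [C] lie inside [S'], so the bonds away from [S'] factor out of each term of
    the alternating sum. *)
Lemma altsum_away Z0 Z S S' c C E : local_observable Z0 Z S c ->
  S \subset S' -> finset.cover C \subset S' -> [disjoint C & E] ->
  altsum Z C (away S' E) = altsum Z C finset.set0 * Z0 (away S' E).
Proof.
move=> [Zf _] SS' CS' dCE; rewrite /altsum mulr_suml; apply: eq_bigr => A AC.
rewrite finset.setU0 -mulrA Zf //.
  exact: disjointWl AC (disjointWr (away_sub _ _) dCE).
apply: disjointWl (disjoint_away S' E); rewrite finset.subUset SS' /=.
apply: fintype.subset_trans CS'; apply/bigcupsP => X XA.
by apply: finset.bigcup_sup; exact: (fintype.subsetP AC).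
Qed.

(** * Decoupling a region from the remaining bonds *)

Context (Z0 : bonds -> R[i]) (A : R).
(** [A] is the loss per site when a region is cut out of [Z0], and must compensate the factor
    [2 - B] arising in [decouples_ratio]. Attaching a bond costs [A] for this ratio and [B] for new
    growth at each of its sites, hence [A * B <= K]. *)
Hypotheses (A_ge1 : 1 <= A) (AB : 1 <= A * (2 - B)) (ABK : A * B <= K).
Hypothesis Z0_local : local_observable Z0 Z0 finset.set0 1.

(* [C] is the set of bonds already found to occur and [S'] the region explored so
   far; the bonds of [E] are still undecided. *)
Definition decouples n := forall E Z S S' (c : R) C, (#|E| <= n)%N -> 0 <= c ->
  local_observable Z0 Z S c -> S \subset S' -> finset.cover C \subset S' ->
  [disjoint C & E] ->
  normc (altsum Z C E - altsum Z C (away S' E)) <=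
    c * (\prod_(X in C) x X) * normc (Z0 (away S' E)) * (growth S' E - 1).

Lemma prod_x_ge0 C : 0 <= \prod_(X in C) x X.
Proof. exact: prodr_ge0. Qed.

(** The bound on the decoupled term [altsum Z C (away S' E)] restores the 1 that [decouples]
    subtracts from [growth]. *)
Lemma decouples_norm n : decouples n -> forall E Z S S' (c : R) C, (#|E| <= n)%N -> 0 <= c ->
  local_observable Z0 Z S c -> S \subset S' -> finset.cover C \subset S' ->
  [disjoint C & E] ->
  normc (altsum Z C E) <=
    c * (\prod_(X in C) x X) * normc (Z0 (away S' E)) * growth S' E.
Proof.
move=> dec E Z S S' c C En c0 Zloc SS' CS' CE.
have := dec E Z S S' c C En c0 Zloc SS' CS' CE.
have := altsum_away Zloc SS' CS' CE; have [_ /(_ C) Zb] := Zloc.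
move=> eqa; rewrite mulrBr mulr1 => le_diff.
have -> : altsum Z C E = (altsum Z C E - altsum Z C (away S' E)) + altsum Z C (away S' E).
  by rewrite subrK.
apply: le_trans (le_normcD _ _) _.
have : normc (altsum Z C (away S' E)) <= c * (\prod_(X in C) x X) * normc (Z0 (away S' E)).
  by rewrite eqa Normc.normcM ler_wpM2r // normc_ge0.
lra.
Qed.

(** Sites are removed one by one. For one site, [decouples] with [Z = Z0] and no chosen bond gives
    [a - |Z0 E'| <= a (B - 1)] for [a = |Z0 (away [set v] E')|], so [a (2 - B) <= |Z0 E'|]. *)
Lemma decouples_ratio n : decouples n -> forall E S, (#|E| <= n)%N ->
  normc (Z0 (away S E)) <= A ^+ #|S| * normc (Z0 E).
Proof.
move=> dec E S; elim/set_ind_setU1: S => [|v S vS IH] En.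
  rewrite cards0 expr0 mul1r le_eqVlt; apply/orP; left; apply/eqP; congr (normc (Z0 _)).
  by apply/setP => Y; rewrite inE -setI_eq0 finset.setI0 eqxx andbT.
rewrite finset.setUC awayU finset.setUC cardsU1 vS exprS -mulrA.
set E' := away S E in IH *.
have E'n : (#|E'| <= n)%N by apply: leq_trans En; exact: subset_leq_card (away_sub _ _).
suff le1 : normc (Z0 (away [set v] E')) <= A * normc (Z0 E').
  by apply: le_trans le1 _; rewrite ler_wpM2l ?(le_trans ler01) // IH.
have := dec E' Z0 finset.set0 [set v] 1 finset.set0 E'n ler01 Z0_local.
rewrite /finset.cover !big_set0 !finset.sub0set mulr1 mul1r => /(_ isT isT).
rewrite -setI_eq0 finset.set0I eqxx !altsum0 => /(_ isT).
set a : R := normc (Z0 (away _ _)) => le_diff.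
have : a <= normc (Z0 E') + a * (B - 1).
  have {1}-> : a = normc (Z0 E' - (Z0 E' - Z0 (away [set v] E'))).
    by rewrite opprB addrC subrK.
  apply: le_trans (ler_normcB _ _) _; rewrite lerD2l.
  apply: le_trans le_diff _; rewrite ler_wpM2l ?normc_ge0 // lerD2r.
  exact: growth_vertex.
have : a <= a * (A * (2 - B)) by rewrite ler_peMr // normc_ge0.
move=> h1 h2.
have : A * (a * (2 - B)) <= A * normc (Z0 E') by rewrite ler_wpM2l ?(le_trans ler01) //; lra.
lra.
Qed.

(** Induction on the number of undecided bonds. If none touches [S'], the difference is zero.
    Otherwise a touching bond [X] is decided: if absent, the region stays; if present, it grows to
    [S' :|: X] at cost [x X * K ^+ #|X|]. The two bounds add up by [growth_set1]. *)
Lemma decouplesP n : decouples n.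
Proof.
elim: n => [|n IH] E Z S S' c C En c0 Zloc SS' CS' CE;
  have pos S1 E1 C1 : 0 <= c * (\prod_(X in C1) x X) * normc (Z0 (away S1 E1))
    by rewrite !mulr_ge0 ?prod_x_ge0 ?normc_ge0.
  have -> : E = finset.set0 by apply/eqP; rewrite -cards_eq0 -leqn0.
  have {1}-> : away S' finset.set0 = finset.set0 by apply/setP => Y; rewrite !inE.
  by rewrite subrr Normc.normc0 mulr_ge0 ?subr_ge0 ?growth_ge1.
case: (pickP (fun X => (X \in E) && ~~ [disjoint X & S'])) => [X /andP[XE XS']|noX]; last first.
  have {1}-> : away S' E = E.
    by apply/setP => X; rewrite inE; have := noX X; case: (X \in E) => //= /negbFE.
  by rewrite subrr Normc.normc0 mulr_ge0 ?subr_ge0 ?growth_ge1.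
set E' := E :\ X; set a := away S' E.
have aE' : away S' E' = a.
  apply/setP => Y; rewrite !inE; case: eqP => [->|//].
  by rewrite XE (negbTE XS').
have E'n : (#|E'| <= n)%N by move: En; rewrite (cardsD1 X) XE.
have XC : X \notin C by apply: contraTN CE => XC; apply/pred0Pn; exists X; rewrite /= XC XE.
have CE' : [disjoint C & E'] by apply: disjointWr CE; rewrite subD1set.
have XCE' : [disjoint X |: C & E'].
  by rewrite disjointsU CE' andbT disjoints1 !inE eqxx.
have XCS' : finset.cover (X |: C) \subset S' :|: X.
  rewrite /finset.cover finset.bigcup_setU big_set1 finset.setUC.
  by rewrite finset.setSU.
have SS'X : S \subset S' :|: X by apply: fintype.subset_trans SS' _; exact: finset.subsetUl.
have h1 := IH E' Z S S' c C E'n c0 Zloc SS' CS' CE'.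
have h2 := decouples_norm IH E'n c0 Zloc SS'X XCS' XCE'.
have -> : altsum Z C E = altsum Z C E' + altsum Z (X |: C) E'.
  by rewrite -altsum_setU1 // finset.setD1K.
rewrite -addrA [altsum Z (X |: C) E' + _]addrC addrA.
apply: le_trans (le_normcD _ _) _; rewrite -aE'.
move: h2; rewrite awayU aE' big_setU1 //= => h2.
move: h1; rewrite aE' => h1.
rewrite (growth_set1 XE XS') -/E'.
have an : (#|a| <= n)%N.
  by rewrite -aE'; apply: leq_trans E'n; exact: subset_leq_card (away_sub _ _).
(* Enlarging the region by [X] costs at most [A ^+ #|X|] in the partition function and [B ^+ #|X|]
   in the growth, together at most [K ^+ #|X|]. *)
have h3 := decouples_ratio IH X an.
have h4 := growthU_le S' X E'.
have g1 := growth_ge1 S' E'.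
set P : R := c * (\prod_(X in C) x X) in h1 h2 *.
have P0 : 0 <= P by rewrite mulr_ge0 ?prod_x_ge0.
have h5 : normc (altsum Z (X |: C) E') <= P * normc (Z0 a) * (x X * K ^+ #|X| * growth S' E').
  apply: le_trans h2 _.
  have -> : c * (x X * \prod_(X in C) x X) * normc (Z0 (away X a)) * growth (S' :|: X) E' =
     P * x X * (normc (Z0 (away X a)) * growth (S' :|: X) E') by rewrite /P; ring.
  have -> : P * normc (Z0 a) * (x X * K ^+ #|X| * growth S' E') =
     P * x X * (K ^+ #|X| * (normc (Z0 a) * growth S' E')) by ring.
  apply: ler_wpM2l; first by rewrite mulr_ge0.
  have U0 : 0 <= growth (S' :|: X) E' by exact: le_trans ler01 (growth_ge1 _ _).
  apply: le_trans (ler_pM (normc_ge0 _) U0 h3 h4) _.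
  have -> : A ^+ #|X| * normc (Z0 a) * (growth S' E' * B ^+ #|X|) =
     (A * B) ^+ #|X| * (normc (Z0 a) * growth S' E') by rewrite exprMn; ring.
  rewrite ler_wpM2r ?mulr_ge0 ?normc_ge0 ?(le_trans ler01 g1) //.
  rewrite lerXn2r ?nnegrE // mulr_ge0 ?(le_trans ler01) //.
  (* [X] meets [S'], so it contains a site [v]; there [1 <= growth [set v] set0 <= B], which gives
     [0 <= B]. *)
  have [v _] : exists v, v \in X.
    by move: XS' => /pred0Pn[v /andP[vX _]]; exists v.
  by apply: le_trans (growth_vertex v finset.set0); exact: growth_ge1.
apply: le_trans (lerD h1 h5) _; lra.
Qed.

(** * Covariances of one observable with a family of observables *)

Context (J : finType) (Zp : bonds -> R[i]) (Zq Zpq : J -> bonds -> R[i]).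
Context (Sp : {set T}) (Sq : J -> {set T}) (cp m M : R) (cq : J -> R).
Hypotheses (cp_ge0 : 0 <= cp) (cq_ge0 : forall j, 0 <= cq j).
Hypothesis Zp_local : local_observable Z0 Zp Sp cp.
Hypothesis Zq_local : forall j, local_observable Z0 (Zq j) (Sq j) (cq j).
Hypothesis Zpq_local : forall j, local_observable Z0 (Zpq j) (Sp :|: Sq j) (cp * cq j).
Hypothesis Zpq_split : forall j E1 E2, [disjoint E1 & E2] ->
  [disjoint Sp :|: finset.cover E1 & Sq j :|: finset.cover E2] ->
  Zpq j (E1 :|: E2) = Zp E1 * Zq j E2.
Hypotheses (K_ge1 : 1 <= K) (M_ge0 : 0 <= M).
Hypothesis cq_vertex : forall v,
  \sum_(j | v \in Sq j) 2 * cq j * (A * B) ^+ #|Sq j| <= m.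
(** When a bond [X] is attached, the observables it newly touches cost [m * #|X|%:R] and later
    extensions cost [M]; with the loss [(A * B) ^+ #|X|] in each of the two copies, all this must
    fit into [M * K ^+ #|X|]. *)
Hypothesis growth_reach : forall X,
  x X * (((A * B) ^+ 2) ^+ #|X| * (m * #|X|%:R + M)) <= x X * (M * K ^+ #|X|).

(** Cost of the observables touched by the region. No cancellation is used for them: the 2 counts
    the two products in a covariance, and [(A * B) ^+ #|Sq j|] pays for adding [Sq j] to the
    region. *)
Definition reach S (Q : {set J}) : R :=
  \sum_(j in Q | ~~ [disjoint Sq j & S]) 2 * cq j * (A * B) ^+ #|Sq j|.

Hypothesis B_ge0 : 0 <= B.

Let A_ge0 : 0 <= A. Proof. exact: le_trans ler01 A_ge1. Qed.

Let reach_term_ge0 j : 0 <= 2 * cq j * (A * B) ^+ #|Sq j|.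
Proof. by rewrite mulr_ge0 ?exprn_ge0 ?mulr_ge0. Qed.

Lemma reach_ge0 S Q : 0 <= reach S Q.
Proof. by apply: sumr_ge0 => j _; exact: reach_term_ge0. Qed.

Lemma reach_le S Q : reach S Q <= m * #|S|%:R.
Proof.
rewrite -[#|S|]sum1_card natr_sum mulr_sumr.
apply: (@le_trans _ _ (\sum_(v in S) \sum_(j | v \in Sq j) 2 * cq j * (A * B) ^+ #|Sq j|)).
  rewrite (exchange_big_dep predT) //= /reach [leRHS](bigID (mem Q)) /=.
  rewrite -[leLHS]addr0 lerD //; last first.
    by apply: sumr_ge0 => j _; apply: sumr_ge0 => v _.
  rewrite [leLHS]big_mkcondr /=; apply: ler_sum => j jQ.
  case: ifP => [/pred0Pn[v /andP[/= vj vS]]|_]; last by apply: sumr_ge0 => v _.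
  rewrite (bigD1 v) ?vS //= lerDl; exact: sumr_ge0.
by apply: ler_sum => v _; rewrite mulr1.
Qed.

(* Two copies of the system, explored simultaneously. *)
Definition covar j C1 C2 E : R[i] :=
  altsum (Zpq j) C1 E * altsum Z0 C2 E - altsum Zp C1 E * altsum (Zq j) C2 E.

Lemma covar_setU1 j C1 C2 E X : X \notin C1 -> X \notin C2 ->
  covar j C1 C2 (X |: E) = covar j C1 C2 E + covar j (X |: C1) C2 E
    + covar j C1 (X |: C2) E + covar j (X |: C1) (X |: C2) E.
Proof. by move=> XC1 XC2; rewrite /covar !altsum_setU1 //; ring. Qed.

(** Exploration from [S :|: S2], expressed through [S] alone: the sites of [S2] cost [A] each in the
    partition function and [B] each in the growth. *)
Lemma altsum_widen Z S1 S S2 c C E : 0 <= c -> local_observable Z0 Z S1 c ->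
  S1 \subset S :|: S2 -> finset.cover C \subset S -> [disjoint C & E] ->
  normc (altsum Z C E) <= c * (\prod_(X in C) x X) *
    ((A * B) ^+ #|S2| * normc (Z0 (away S E)) * growth S E).
Proof.
move=> c0 Zloc S1S CS CE.
have CS' : finset.cover C \subset S :|: S2.
  by apply: fintype.subset_trans CS _; exact: finset.subsetUl.
apply: le_trans (decouples_norm (@decouplesP #|E|) (leqnn _) c0 Zloc S1S CS' CE) _.
rewrite -mulrA; apply: ler_wpM2l; first by rewrite mulr_ge0 ?prod_x_ge0.
have h1 : normc (Z0 (away (S :|: S2) E)) <= A ^+ #|S2| * normc (Z0 (away S E)).
  by rewrite awayU; exact: decouples_ratio (@decouplesP _) _ _ (leqnn _).
have g0 : 0 <= growth (S :|: S2) E by exact: le_trans ler01 (growth_ge1 _ _).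
apply: le_trans (ler_pM (normc_ge0 _) g0 h1 (growthU_le _ _ _)) _.
by rewrite exprMn le_eqVlt; apply/orP; left; apply/eqP; ring.
Qed.

(** The two products are bounded separately. [Sq j] enlarges the region only in the factors of
    [Zpq j] and [Zq j], so each product pays for it once. *)
Lemma covar_touching j C1 C2 E S : Sp \subset S -> finset.cover C1 \subset S ->
  finset.cover C2 \subset S -> [disjoint C1 & E] -> [disjoint C2 & E] ->
  normc (covar j C1 C2 E) <=
    cp * (\prod_(X in C1) x X) * (\prod_(X in C2) x X) * normc (Z0 (away S E)) ^+ 2 *
    (2 * cq j * (A * B) ^+ #|Sq j| * growth S E ^+ 2).
Proof.
move=> SpS C1S C2S C1E C2E.
have SU0 (S1 S2 : {set T}) : S1 \subset S -> S1 \subset S :|: S2.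
  by move=> h; apply: fintype.subset_trans h _; exact: finset.subsetUl.
have pq := altsum_widen (mulr_ge0 cp_ge0 (cq_ge0 j)) (Zpq_local j) (finset.setSU _ SpS) C1S C1E.
have z0 := altsum_widen ler01 Z0_local (SU0 _ finset.set0 (finset.sub0set _)) C2S C2E.
have zp := altsum_widen cp_ge0 Zp_local (SU0 _ finset.set0 SpS) C1S C1E.
have q := altsum_widen (cq_ge0 j) (Zq_local j) (finset.subsetUr S _) C2S C2E.
move: z0 zp; rewrite cards0 expr0 !mul1r => z0 zp.
apply: le_trans (ler_normcB _ _) _; rewrite !Normc.normcM.
apply: le_trans (lerD (ler_pM (normc_ge0 _) (normc_ge0 _) pq z0)
  (ler_pM (normc_ge0 _) (normc_ge0 _) zp q)) _.
by rewrite le_eqVlt; apply/orP; left; apply/eqP; ring.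
Qed.

(** Both products equal [altsum Zp C1 set0 * altsum Z0 C2 set0 * Zq j E * Z0 E]: the bonds of [E]
    and the support [Sq j] split off from the explored region, and only the copies they belong to
    are exchanged. *)
Lemma covar_separated j C1 C2 E S : Sp \subset S -> finset.cover C1 \subset S ->
  finset.cover C2 \subset S -> [disjoint C1 & E] -> [disjoint C2 & E] ->
  away S E = E -> [disjoint Sq j & S] -> covar j C1 C2 E = 0.
Proof.
move=> SpS C1S C2S C1E C2E aE qS.
have SE : [disjoint S & finset.cover E] by rewrite -aE disjoint_away.
have CS (A1 C : bonds) : finset.cover C \subset S -> A1 \subset C -> finset.cover A1 \subset S.
  move=> CS AC; apply: fintype.subset_trans CS; apply/finset.bigcupsP => X XA.
  by apply: finset.bigcup_sup; exact: (fintype.subsetP AC).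
have e0 := altsum_away Z0_local (finset.sub0set S) C2S C2E.
have ep := altsum_away Zp_local SpS C1S C1E.
rewrite /covar; move: e0 ep; rewrite aE => -> ->.
have -> : altsum (Zpq j) C1 E = altsum Zp C1 finset.set0 * Zq j E.
  rewrite /altsum mulr_suml; apply: eq_bigr => A1 A1C.
  rewrite finset.setU0 -mulrA Zpq_split //; first exact: disjointWl A1C C1E.
  apply: (@disjointWl _ _ S); first by rewrite finset.subUset SpS (CS _ C1).
  by rewrite disjoint_sym disjointsU qS disjoint_sym.
have -> : altsum (Zq j) C2 E = altsum Z0 C2 finset.set0 * Zq j E.
  rewrite /altsum mulr_suml; apply: eq_bigr => A1 A1C.
  rewrite finset.setU0 finset.setUC -mulrA; congr (_ * _).
  have [-> //] := Zq_local j; first by rewrite mulrC.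
    by rewrite disjoint_sym (disjointWl A1C C2E).
  by apply: disjointWr (CS _ _ C2S A1C) _; rewrite disjointsU qS disjoint_sym.
ring.
Qed.

(** Observables touching [S] are charged to [reach]. The others cancel if no bond touches [S];
    otherwise a touching bond is decided in both copies, and the region grows in three of the four
    cases. *)
Lemma covar_sum_le n E S C1 C2 (Q : {set J}) : (#|E| <= n)%N -> Sp \subset S ->
  finset.cover C1 \subset S -> finset.cover C2 \subset S ->
  [disjoint C1 & E] -> [disjoint C2 & E] ->
  \sum_(j in Q) normc (covar j C1 C2 E) <=
    cp * (\prod_(X in C1) x X) * (\prod_(X in C2) x X) * normc (Z0 (away S E)) ^+ 2 *
    (reach S Q * growth S E ^+ 2 + M * (growth S E ^+ 2 - 1)).
Proof.
elim: n E S C1 C2 Q => [|n IH] E S C1 C2 Q En SpS C1S C2S C1E C2E;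
  set W : R := cp * _ * _ * _;
  have W0 : 0 <= W
    by exact: mulr_ge0 (mulr_ge0 (mulr_ge0 cp_ge0 (prod_x_ge0 C1)) (prod_x_ge0 C2)) (sqr_ge0 _).
all: have touched : \sum_(j in Q | ~~ [disjoint Sq j & S]) normc (covar j C1 C2 E) <=
    W * (reach S Q * growth S E ^+ 2)
  by rewrite /reach mulr_suml mulr_sumr; apply: ler_sum => j _; exact: covar_touching.
all: rewrite (bigID (fun j => [disjoint Sq j & S])) /= addrC mulrDr; apply: lerD => //.
all: have g1 : 0 <= M * (growth S E ^+ 2 - 1)
  by rewrite mulr_ge0 ?subr_ge0 ?exprn_ege1 ?growth_ge1.
all: have sep : away S E = E -> \sum_(j in Q | [disjoint Sq j & S]) normc (covar j C1 C2 E)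
    <= W * (M * (growth S E ^+ 2 - 1))
  by move=> aE; rewrite big1 ?(mulr_ge0 W0 g1) // => j /andP[_ qS];
     rewrite (covar_separated SpS C1S C2S C1E C2E aE qS) Normc.normc0.
  apply: sep; have -> : E = finset.set0 by apply/eqP; rewrite -cards_eq0 -leqn0.
  by apply/setP => Y; rewrite !inE.
case: (pickP (fun X => (X \in E) && ~~ [disjoint X & S])) => [X /andP[XE XS]|noX]; last first.
  apply: sep.
  by apply/setP => X; rewrite inE; have := noX X; case: (X \in E) => //= /negbFE.
clear sep touched.
pose E' := E :\ X; pose a := away S E.
have aE' : away S E' = a.
  apply/setP => Y; rewrite !inE; case: eqP => [->|//].
  by rewrite XE (negbTE XS).
have E'n : (#|E'| <= n)%N by move: En; rewrite (cardsD1 X) XE.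
have XnC C : [disjoint C & E] -> X \notin C.
  by move=> CE; apply: contraTN CE => XC; apply/pred0Pn; exists X; rewrite /= XC XE.
have CE' C : [disjoint C & E] -> [disjoint C & E'].
  by apply: disjointWr; rewrite subD1set.
have XCE' C : [disjoint C & E] -> [disjoint X |: C & E'].
  by move=> CE; rewrite disjointsU (CE' C CE) andbT disjoints1 !inE eqxx.
have SSX (S1 : {set T}) : S1 \subset S -> S1 \subset S :|: X.
  by move=> h; apply: fintype.subset_trans h _; exact: finset.subsetUl.
have XCS' C : finset.cover C \subset S -> finset.cover (X |: C) \subset S :|: X.
  by move=> CS; rewrite /finset.cover finset.bigcup_setU big_set1 finset.setUC finset.setSU.
(* The observables of [Q'] are untouched by [S], so the region [S :|: X] can reach them only through
   [X]; this keeps the cost of a new bond at [m * #|X|%:R]. *)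
pose Q' : {set J} := [set j in Q | [disjoint Sq j & S]].
have r0 : reach S Q' = 0.
  by rewrite /reach big1 // => j; rewrite inE -andbA => /and3P[_ ->].
have rX : reach (S :|: X) Q' <= m * #|X|%:R.
  apply: le_trans (reach_le X Q'); rewrite /reach le_eqVlt; apply/orP; left; apply/eqP.
  apply: eq_bigl => j; rewrite inE; apply: andb_id2l => /andP[_ jS].
  by rewrite disjoint_sym disjointsU disjoint_sym jS /= disjoint_sym.
pose U := growth S E'; have U1 : 1 <= U by exact: growth_ge1.
have U0 : 0 <= U by exact: le_trans ler01 U1.
(* Cost of attaching [X], relative to [|Z0 a| ^+ 2 * U ^+ 2]; it is the same whether one or both
   copies contain [X]. *)
pose G := ((A * B) ^+ 2) ^+ #|X| * (m * #|X|%:R + M).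
have mX : 0 <= m * #|X|%:R by exact: le_trans (reach_ge0 X Q) (reach_le _ _).
have IHX D1 D2 : finset.cover D1 \subset S :|: X -> finset.cover D2 \subset S :|: X ->
    [disjoint D1 & E'] -> [disjoint D2 & E'] ->
    \sum_(j in Q') normc (covar j D1 D2 E') <=
    cp * (\prod_(X in D1) x X) * (\prod_(X in D2) x X) * (normc (Z0 a) ^+ 2 * (U ^+ 2 * G)).
  move=> D1S D2S D1E D2E; apply: le_trans (IH E' _ D1 D2 Q' E'n (SSX _ SpS) D1S D2S D1E D2E) _.
  rewrite -mulrA; apply: ler_wpM2l; first by rewrite !mulr_ge0 ?prod_x_ge0.
  have an : (#|a| <= n)%N.
    by rewrite -aE'; apply: leq_trans E'n; exact: subset_leq_card (away_sub _ _).
  have h3 := decouples_ratio (@decouplesP n) X an.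
  have h4 := growthU_le S X E'; have g1' := growth_ge1 (S :|: X) E'.
  have h3' : normc (Z0 (away (S :|: X) E')) ^+ 2 <= (A ^+ #|X|) ^+ 2 * normc (Z0 a) ^+ 2.
    by rewrite awayU aE' -exprMn lerXn2r ?nnegrE ?normc_ge0 ?mulr_ge0 ?exprn_ge0 ?normc_ge0.
  have h4' : growth (S :|: X) E' ^+ 2 <= U ^+ 2 * (B ^+ #|X|) ^+ 2.
    by rewrite -exprMn lerXn2r ?nnegrE ?mulr_ge0 ?exprn_ge0 // (le_trans ler01).
  have h5 : reach (S :|: X) Q' * growth (S :|: X) E' ^+ 2 +
      M * (growth (S :|: X) E' ^+ 2 - 1) <= (m * #|X|%:R + M) * (U ^+ 2 * (B ^+ #|X|) ^+ 2).
    apply: (@le_trans _ _ ((m * #|X|%:R + M) * growth (S :|: X) E' ^+ 2)); last first.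
      by rewrite ler_wpM2l // addr_ge0.
    have : reach (S :|: X) Q' * growth (S :|: X) E' ^+ 2 <=
        m * #|X|%:R * growth (S :|: X) E' ^+ 2 by rewrite ler_wpM2r ?sqr_ge0.
    rewrite mulrBr mulr1 mulrDl addrA => hr; rewrite lerBlDr.
    apply: le_trans (lerD hr (lexx _)) _.
    by rewrite lerDl.
  apply: le_trans (ler_pM (sqr_ge0 _) _ h3' h5) _.
    apply: addr_ge0; first exact: mulr_ge0 (reach_ge0 _ _) (sqr_ge0 _).
    by apply: mulr_ge0 => //; rewrite subr_ge0 exprn_ege1.
  rewrite /G le_eqVlt; apply/orP; left; apply/eqP.
  rewrite [(A ^+ _) ^+ 2]exprAC [(B ^+ _) ^+ 2]exprAC !exprMn.
  by move: ((A ^+ 2) ^+ #|X|) ((B ^+ 2) ^+ #|X|) => u v; ring.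
have h1 := IH E' S C1 C2 Q' E'n SpS C1S C2S (CE' _ C1E) (CE' _ C2E).
have h2 := IHX _ _ (XCS' _ C1S) (SSX _ C2S) (XCE' _ C1E) (CE' _ C2E).
have h3 := IHX _ _ (SSX _ C1S) (XCS' _ C2S) (CE' _ C1E) (XCE' _ C2E).
have h4 := IHX _ _ (XCS' _ C1S) (XCS' _ C2S) (XCE' _ C1E) (XCE' _ C2E).
have -> : \sum_(j in Q | [disjoint Sq j & S]) normc (covar j C1 C2 E) =
    \sum_(j in Q') normc (covar j C1 C2 E) by apply: eq_bigl => j; rewrite inE.
apply: (@le_trans _ _ (\sum_(j in Q') (normc (covar j C1 C2 E') +
  normc (covar j (X |: C1) C2 E') + normc (covar j C1 (X |: C2) E') +
  normc (covar j (X |: C1) (X |: C2) E')))).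
  apply: ler_sum => j _; rewrite -(finset.setD1K XE) -/E' covar_setU1 ?XnC //.
  by do 3!(apply: le_trans (le_normcD _ _) _; rewrite lerD2r).
rewrite !big_split /=.
apply: le_trans (lerD (lerD (lerD h1 h2) h3) h4) _.
rewrite !big_setU1 ?XnC //= (growth_set1 XE XS) -/E' -/U aE' r0 mul0r add0r -/a.
set k := K ^+ #|X|; have k1 : 1 <= k by rewrite exprn_ege1.
have Gk : x X * G <= x X * (M * k) by exact: growth_reach.
have WE : W = cp * (\prod_(X in C1) x X) * (\prod_(X in C2) x X) * normc (Z0 a) ^+ 2 by [].
have -> : cp * \prod_(X in C1) x X * \prod_(X in C2) x X * normc (Z0 a) ^+ 2 * (M * (U ^+ 2 - 1)) +
    cp * (x X * \prod_(X in C1) x X) * \prod_(X in C2) x X * (normc (Z0 a) ^+ 2 * (U ^+ 2 * G)) +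
    cp * \prod_(X in C1) x X * (x X * \prod_(X in C2) x X) * (normc (Z0 a) ^+ 2 * (U ^+ 2 * G)) +
    cp * (x X * \prod_(X in C1) x X) * (x X * \prod_(X in C2) x X) * (normc (Z0 a) ^+ 2 * (U ^+ 2 * G)) =
    W * (M * (U ^+ 2 - 1) + U ^+ 2 * (2 * (x X * G) + x X * (x X * G))) by rewrite WE; ring.
apply: ler_wpM2l => //.
have xx : x X * (x X * G) <= x X * (x X * (M * k)) by rewrite ler_wpM2l.
(* The new factor [(1 + x X * k) ^+ 2] contains [(x X * k) ^+ 2], while [growth_reach] yields a
   single [k]; [1 <= k] supplies the other. *)
have xk : x X * (x X * (M * k)) <= x X * (x X * (M * k)) * k.
  by rewrite ler_peMr // !mulr_ge0 // (le_trans ler01).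
have : U ^+ 2 * (2 * (x X * G) + x X * (x X * G)) <=
    U ^+ 2 * (2 * (x X * (M * k)) + x X * (x X * (M * k)) * k).
  rewrite ler_wpM2l ?sqr_ge0 //; apply: lerD; first by rewrite ler_wpM2l.
  exact: le_trans xx xk.
move=> hh; apply: le_trans (lerD (lexx _) hh) _.
by rewrite le_eqVlt; apply/orP; left; apply/eqP; ring.
Qed.

(** The exploration starts from the region [Sp] with no chosen bond; ratio, growth and reach are
    then replaced by their bounds per site. *)
Lemma covariance_bound E :
  \sum_j normc (Zpq j E * Z0 E - Zp E * Zq j E) <=
    cp * normc (Z0 E) ^+ 2 * ((A * B) ^+ 2) ^+ #|Sp| * (m * #|Sp|%:R + M).
Proof.
have := @covar_sum_le _ E Sp finset.set0 finset.set0 [set: J] (leqnn _) (subxx _).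
rewrite /finset.cover !big_set0 !finset.sub0set => /(_ isT isT).
rewrite -setI_eq0 finset.set0I eqxx => /(_ isT isT).
rewrite (eq_bigr (fun j => normc (Zpq j E * Z0 E - Zp E * Zq j E))); last first.
  by move=> j _; rewrite /covar !altsum0.
rewrite (eq_bigl predT) => [h|j]; last by rewrite inE.
apply: le_trans h _; rewrite !mulr1.
have g1 := growth_ge1 Sp E.
have mS : 0 <= m * #|Sp|%:R by exact: le_trans (reach_ge0 Sp [set: J]) (reach_le _ _).
rewrite -[leLHS]mulrA -[leRHS]mulrA -[leRHS]mulrA; apply: ler_wpM2l => //.
have h1 : normc (Z0 (away Sp E)) ^+ 2 <= (A ^+ #|Sp|) ^+ 2 * normc (Z0 E) ^+ 2.
  rewrite -exprMn; apply: lerXn2r; rewrite ?nnegrE ?normc_ge0 //.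
    by apply: mulr_ge0; rewrite ?exprn_ge0 ?normc_ge0.
  by have := decouples_ratio (@decouplesP #|E|) Sp (leqnn _).
have h2 : growth Sp E ^+ 2 <= (B ^+ #|Sp|) ^+ 2.
  by rewrite lerXn2r ?nnegrE ?exprn_ge0 ?growth_le // (le_trans ler01).
have h3 : reach Sp [set: J] * growth Sp E ^+ 2 + M * (growth Sp E ^+ 2 - 1) <=
    (m * #|Sp|%:R + M) * (B ^+ #|Sp|) ^+ 2.
  apply: (@le_trans _ _ ((m * #|Sp|%:R + M) * growth Sp E ^+ 2)); last first.
    by rewrite ler_wpM2l // addr_ge0.
  have : reach Sp [set: J] * growth Sp E ^+ 2 <= m * #|Sp|%:R * growth Sp E ^+ 2.
    by rewrite ler_wpM2r ?sqr_ge0 // reach_le.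
  rewrite mulrBr mulr1 mulrDl addrA => hr; rewrite lerBlDr.
  apply: le_trans (lerD hr (lexx _)) _.
  by rewrite lerDl.
apply: le_trans (ler_pM (sqr_ge0 _) _ h1 h3) _.
  apply: addr_ge0; first exact: mulr_ge0 (reach_ge0 _ _) (sqr_ge0 _).
  by apply: mulr_ge0 => //; rewrite subr_ge0 exprn_ege1.
rewrite le_eqVlt; apply/orP; left; apply/eqP.
rewrite [(A ^+ _) ^+ 2]exprAC [(B ^+ _) ^+ 2]exprAC !exprMn.
by move: ((A ^+ 2) ^+ #|Sp|) ((B ^+ 2) ^+ #|Sp|) => u v; ring.
Qed.

End ClusterExpansion.

(** * Operator norm *)

(** Sum of the inequalities [0 <= (q * a i - p * b i) ^+ 2 / 2], with [p] and [q] the two norms. *)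
Lemma cauchy_schwarz_sum (R : rcfType) (I : finType) (a b : I -> R) :
  \sum_i a i * b i <= Num.sqrt (\sum_i a i ^+ 2) * Num.sqrt (\sum_i b i ^+ 2).
Proof.
have sum_ge0 (c : I -> R) : 0 <= \sum_i c i ^+ 2 by apply: sumr_ge0 => i _; exact: sqr_ge0.
have sum0 (c : I -> R) : Num.sqrt (\sum_i c i ^+ 2) = 0 -> forall i, c i = 0.
  move/eqP; rewrite sqrtr_eq0 => le0 i.
  have /eqP : \sum_i c i ^+ 2 = 0 by apply/eqP; rewrite eq_le le0 sum_ge0.
  rewrite psumr_eq0 => [/allP /(_ i (mem_index_enum i))|j _]; last exact: sqr_ge0.
  by rewrite sqrf_eq0 => /eqP.
set p := Num.sqrt (\sum_i a i ^+ 2); set q := Num.sqrt (\sum_i b i ^+ 2).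
have [p0|pn0] := eqVneq p 0.
  by rewrite p0 mul0r big1 // => i _; rewrite (sum0 a p0) mul0r.
have [q0|qn0] := eqVneq q 0.
  by rewrite q0 mulr0 big1 // => i _; rewrite (sum0 b q0) mulr0.
have pq : 0 < p * q by rewrite mulr_gt0 // lt0r ?pn0 ?qn0 sqrtr_ge0.
rewrite -(ler_pM2l pq) mulr_sumr.
apply: (@le_trans _ _ (\sum_i (2^-1 * q ^+ 2 * a i ^+ 2 + 2^-1 * p ^+ 2 * b i ^+ 2))).
  apply: ler_sum => i _; rewrite -subr_ge0.
  have -> : 2^-1 * q ^+ 2 * a i ^+ 2 + 2^-1 * p ^+ 2 * b i ^+ 2 - p * q * (a i * b i) =
    2^-1 * (q * a i - p * b i) ^+ 2 by field.
  by rewrite mulr_ge0 ?sqr_ge0 // invr_ge0.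
rewrite big_split /= -!mulr_sumr -(sqr_sqrtr (sum_ge0 a)) -(sqr_sqrtr (sum_ge0 b)) -/p -/q.
by rewrite le_eqVlt; apply/orP; left; apply/eqP; field.
Qed.

Section OperatorNorm.
Context (R : realType).
Local Notation normc := (@Normc.normc R).

Lemma vnorm_ge0 m (v : 'cV[R[i]]_m) : 0 <= vnorm v.
Proof. exact: sqrtr_ge0. Qed.

Lemma sumsq_ge0 m (v : 'cV[R[i]]_m) : 0 <= \sum_i normc (v i ord0) ^+ 2.
Proof. by apply: sumr_ge0 => i _; exact: sqr_ge0. Qed.

Lemma vnormZ m (c : R[i]) (v : 'cV[R[i]]_m) : vnorm (c *: v) = normc c * vnorm v.
Proof.
rewrite /vnorm (eq_bigr (fun i => normc c ^+ 2 * normc (v i ord0) ^+ 2)).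
  by rewrite -mulr_sumr sqrtrM ?sqr_ge0 // sqrtr_sqr ger0_norm ?normc_ge0.
by move=> i _; rewrite mxE Normc.normcM exprMn.
Qed.

Lemma vnormD m (u v : 'cV[R[i]]_m) : vnorm (u + v) <= vnorm u + vnorm v.
Proof.
rewrite -[leRHS]ger0_norm ?addr_ge0 ?vnorm_ge0 // -sqrtr_sqr.
apply: ler_wsqrtr.
apply: (@le_trans _ _ (\sum_i (normc (u i ord0) + normc (v i ord0)) ^+ 2)).
  apply: ler_sum => i _; rewrite mxE.
  by apply: lerXn2r; rewrite ?nnegrE ?addr_ge0 ?normc_ge0 // le_normcD.
rewrite (eq_bigr (fun i => normc (u i ord0) ^+ 2 +
  2 * (normc (u i ord0) * normc (v i ord0)) + normc (v i ord0) ^+ 2)); last first.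
  by move=> i _; ring.
rewrite !big_split /= -mulr_sumr sqrrD !sqr_sqrtr ?sumsq_ge0 //.
rewrite lerD2r lerD2l -[leRHS]mulr_natl ler_wpM2l //.
exact: (@cauchy_schwarz_sum _ _ (fun i => normc (u i ord0)) (fun i => normc (v i ord0))).
Qed.

Lemma normc_le_vnorm m (v : 'cV[R[i]]_m) i : normc (v i ord0) <= vnorm v.
Proof.
rewrite -[leLHS]ger0_norm ?normc_ge0 // -sqrtr_sqr; apply: ler_wsqrtr.
by rewrite (bigD1 i) //= lerDl sumr_ge0 // => j _; exact: sqr_ge0.
Qed.

Lemma vnorm_sum m (J : Type) (r : seq J) (v : J -> 'cV[R[i]]_m) :
  vnorm (\sum_(j <- r) v j) <= \sum_(j <- r) vnorm (v j).
Proof.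
elim/big_rec2: _ => [|j y x _ le_xy].
  by rewrite /vnorm big1 ?sqrtr0 // => i _; rewrite mxE Normc.normc0 expr0n.
by apply: le_trans (vnormD _ _) _; rewrite lerD2l.
Qed.

Lemma vnorm0 m : vnorm (0 : 'cV[R[i]]_m) = 0.
Proof. by rewrite /vnorm big1 ?sqrtr0 // => i _; rewrite mxE Normc.normc0 expr0n. Qed.

Lemma vnorm_eq0 m (v : 'cV[R[i]]_m) : vnorm v = 0 -> v = 0.
Proof.
move=> v0; apply/matrixP => i j; rewrite ord1 mxE; apply: Normc.eq0_normc.
by apply/eqP; rewrite eq_le normc_ge0 -v0 normc_le_vnorm.
Qed.

Lemma vnorm_delta m (j : 'I_m) : vnorm (delta_mx j ord0 : 'cV[R[i]]_m) = 1.
Proof.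
rewrite /vnorm (bigD1 j) //= big1 ?addr0; last first.
  by move=> i ij; rewrite mxE (negbTE ij) Normc.normc0 expr0n.
by rewrite mxE !eqxx Normc.normc1 expr1n sqrtr1.
Qed.

Context (m : nat).
Implicit Types (A B : 'M[R[i]]_m) (v : 'cV[R[i]]_m).

Lemma opnorm_set_bounded A :
  has_ubound [set vnorm (A *m v) | v in [set v : 'cV[R[i]]_m | vnorm v = 1]]%classic.
Proof.
exists (\sum_j vnorm (col j A)) => _ [v /= v1 <-].
have -> : A *m v = \sum_j v j ord0 *: col j A.
  apply/matrixP => i j; rewrite ord1 !mxE summxE; apply: eq_bigr => k _.
  by rewrite !mxE mulrC.
apply: le_trans (vnorm_sum _ _) _; apply: ler_sum => j _.
by rewrite vnormZ ler_piMl ?vnorm_ge0 // -v1 normc_le_vnorm.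
Qed.

Lemma vnorm_mulmx A v : vnorm (A *m v) <= opnorm A * vnorm v.
Proof.
have [v0|vn0] := eqVneq (vnorm v) 0.
  by rewrite (vnorm_eq0 v0) mulmx0 vnorm0 mulr0.
have vp : 0 < vnorm v by rewrite lt0r vn0 vnorm_ge0.
pose u := real_complex R (vnorm v)^-1 *: v.
have u1 : vnorm u = 1 by rewrite vnormZ normc_real ger0_norm ?invr_ge0 ?vnorm_ge0 // mulVf.
have vE : v = real_complex R (vnorm v) *: u.
  by rewrite /u scalerA -rmorphM divff // rmorph1 scale1r.
rewrite {1}vE -scalemxAr vnormZ normc_real ger0_norm ?vnorm_ge0 // mulrC.
rewrite ler_wpM2r ?vnorm_ge0 //; apply: ub_le_sup; first exact: opnorm_set_bounded.
by exists u.
Qed.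

Lemma opnorm_le A c : 0 <= c -> (forall v, vnorm (A *m v) <= c * vnorm v) -> opnorm A <= c.
Proof.
move=> c0 Ac; rewrite /opnorm.
set S := (X in sup X).
(* In dimension 0 there is no unit vector, and [sup] of the empty set is 0. *)
have [->|/set0P Sn0] := eqVneq S set0; first by rewrite sup0.
by apply: ge_sup => // _ [v /= v1 <-]; apply: le_trans (Ac v) _; rewrite v1 mulr1.
Qed.

Lemma opnorm_ge0 A : 0 <= opnorm A.
Proof.
rewrite /opnorm; set S := (X in sup X).
have [->|/set0P [_ [v /= v1 _]]] := eqVneq S set0; first by rewrite sup0.
by have := le_trans (vnorm_ge0 _) (vnorm_mulmx A v); rewrite v1 mulr1.
Qed.

Lemma opnormD A B : opnorm (A + B) <= opnorm A + opnorm B.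
Proof.
apply: opnorm_le => [|v]; first by rewrite addr_ge0 ?opnorm_ge0.
rewrite mulmxDl mulrDl; apply: le_trans (vnormD _ _) _.
by rewrite lerD ?vnorm_mulmx.
Qed.

Lemma opnormM A B : opnorm (A *m B) <= opnorm A * opnorm B.
Proof.
apply: opnorm_le => [|v]; first by rewrite mulr_ge0 ?opnorm_ge0.
rewrite -mulmxA -mulrA; apply: le_trans (vnorm_mulmx _ _) _.
by rewrite ler_wpM2l ?opnorm_ge0 ?vnorm_mulmx.
Qed.

Lemma opnormZ (c : R[i]) A : opnorm (c *: A) <= normc c * opnorm A.
Proof.
apply: opnorm_le => [|v]; first by rewrite mulr_ge0 ?opnorm_ge0 ?normc_ge0.
by rewrite -scalemxAl vnormZ -mulrA ler_wpM2l ?normc_ge0 ?vnorm_mulmx.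
Qed.

Lemma opnorm0 : opnorm (0 : 'M[R[i]]_m) = 0.
Proof.
apply/eqP; rewrite eq_le opnorm_ge0 andbT; apply: opnorm_le => // v.
by rewrite mul0mx vnorm0 mul0r.
Qed.

Lemma opnorm1 : opnorm (1%:M : 'M[R[i]]_m) <= 1.
Proof. by apply: opnorm_le => // v; rewrite mul1mx mul1r. Qed.

Lemma opnorm_sum (J : Type) (r : seq J) (P : pred J) (F : J -> 'M[R[i]]_m) :
  opnorm (\sum_(j <- r | P j) F j) <= \sum_(j <- r | P j) opnorm (F j).
Proof.
elim/big_rec2: _ => [|j y x _ le_xy]; first by rewrite opnorm0.
by apply: le_trans (opnormD _ _) _; rewrite lerD2l.
Qed.

Lemma opnormX A k : opnorm (A ^+ k) <= opnorm A ^+ k.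
Proof.
elim: k => [|k IH]; first by rewrite !expr0 opnorm1.
by rewrite !exprS; apply: le_trans (opnormM _ _) _; rewrite ler_wpM2l ?opnorm_ge0.
Qed.

Lemma normc_le_opnorm A i j : normc (A i j) <= opnorm A.
Proof.
have := vnorm_mulmx A (delta_mx j ord0); rewrite vnorm_delta mulr1; apply: le_trans.
rewrite -colE; have -> : A i j = col j A i ord0 by rewrite mxE.
exact: normc_le_vnorm.
Qed.

Lemma normc_mxtrace A : normc (\tr A) <= m%:R * opnorm A.
Proof.
apply: le_trans (ler_normc_sum _ _ _) _.
rewrite -[m in m%:R]card_ord -sum1_card natr_sum mulr_suml.
by apply: ler_sum => i _; rewrite mul1r normc_le_opnorm.
Qed.

End OperatorNorm.

(** * Limits of complex matrices *)

Section MatrixLimits.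
Context (K : numFieldType).
Local Open Scope classical_set_scope.

Lemma cvg_csum (I : Type) (r : seq I) (P : pred I) (f : I -> nat -> K) (l : I -> K) :
  (forall i, f i @ \oo --> l i) ->
  (fun N => \sum_(i <- r | P i) f i N) @ \oo --> \sum_(i <- r | P i) l i.
Proof.
move=> fl; elim: r => [|i r IH].
  by rewrite big_nil; under eq_fun do rewrite big_nil; exact: cvg_cst.
rewrite big_cons; under eq_fun do rewrite big_cons.
by case: (P i) => //; exact: (cvgD (fl i) IH).
Qed.

Lemma cvg_altsum (I : finType) (Z : nat -> {set I} -> K) (l : {set I} -> K) C E :
  (forall A, (fun N => Z N A) @ \oo --> l A) ->
  (fun N => altsum (Z N) C E) @ \oo --> altsum l C E.
Proof.
move=> Zl; apply: (cvg_csum (f := fun (A : {set I}) N => (-1) ^+ #|C :\: A| * Z N (A :|: E))) => A.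
exact: cvgM (cvg_cst _) (Zl _).
Qed.

(** Entrywise convergence reduces sums, products and traces to scalar limits; [mxcvg_lim] returns to
    the topological limit in [mexp]. *)
Definition mxcvg m (u : nat -> 'M[K]_m) (L : 'M[K]_m) : Prop :=
  forall i j, (fun N => u N i j : K) @ \oo --> (L i j : K).

Lemma mxcvg_mul m (u v : nat -> 'M[K]_m) L M : mxcvg u L -> mxcvg v M ->
  mxcvg (fun N => u N *m v N) (L *m M).
Proof.
move=> uL vM i j.
rewrite mxE; under eq_fun do rewrite mxE.
apply: (cvg_csum (f := fun k N => u N i k * v N k j)) => k.
exact: (cvgM (uL i k) (vM k j)).
Qed.

Lemma mxcvgB m (u v : nat -> 'M[K]_m) L M : mxcvg u L -> mxcvg v M ->
  mxcvg (fun N => u N - v N) (L - M).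
Proof.
move=> uL vM i j; rewrite !mxE; under eq_fun do rewrite !mxE.
exact: (cvgB (uL i j) (vM i j)).
Qed.

Lemma mxcvg_cst m (L : 'M[K]_m) : mxcvg (fun=> L) L.
Proof. by move=> i j; exact: cvg_cst. Qed.

Lemma mxcvg_trace m (u : nat -> 'M[K]_m) L : mxcvg u L ->
  (fun N => \tr (u N) : K) @ \oo --> (\tr L : K).
Proof. by move=> uL; apply: (cvg_csum (f := fun k N => u N k k)). Qed.

Lemma mxcvg_lim m (u : nat -> 'M[K]_m) L : mxcvg u L ->
  lim ((u : nat -> 'M[K]_m) @ \oo) = L.
Proof.
case: m u L => [|m] u L uL; first by rewrite [LHS]flatmx0 [RHS]flatmx0.
apply/cvg_lim; first exact: norm_hausdorff.
apply/cvg_mx_entourageP => A entA.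
have near_ij i j : \forall N \near \oo, (L i j, u N i j) \in A.
  have /cvg_app_entourageP /(_ A entA) h := uL i j.
  by near=> N; rewrite inE; near: N.
have near_i i := filter_forall eventually_filter (near_ij i).
exact: (filter_forall eventually_filter near_i).
Unshelve. all: by end_near.
Qed.

End MatrixLimits.

(** * Limits of complex sequences *)

Section ComplexLimits.
Context (R : realType).
Local Notation normc := (@Normc.normc R).
Local Notation C := (R[i] : numFieldType).
Local Open Scope classical_set_scope.

Lemma cvg_real_complex (u : nat -> R) (l : R) :
  u @ \oo --> l -> ((fun N => real_complex R (u N) : C) @ \oo --> (real_complex R l : C)).
Proof.
move=> ul; apply/cvgrPdist_lt => e e0.
have [Re0 eE] : 0 < complex.Re e /\ e = real_complex R (complex.Re e).
  case: e e0 => a b; rewrite ltcE /= => /andP[/eqP -> a0]; split => //.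
near=> N; rewrite -rmorphB /= normc_def /= expr0n addr0 sqrtr_sqr eE ltcR.
near: N; move/cvgrPdist_lt: ul; exact.
Unshelve. all: by end_near. Qed.

Lemma normc_cvg_le (u : nat -> C) (l : C) (r : nat -> R) (s : R) :
  (forall N, normc (u N) <= r N) -> u @ \oo --> l -> r @ \oo --> s -> normc l <= s.
Proof.
move=> ur ul rs; apply/ler_addgt0Pr => e e0.
have e2 : 0 < e / 2 by rewrite divr_gt0.
have e2C : 0 < real_complex R (e / 2) :> R[i] by rewrite ltcR.
near \oo => N.
have h1 : normc (l - u N) < e / 2.
  rewrite -ltcR; near: N; move/cvgrPdist_lt : ul => /(_ _ e2C).
  by apply: filterS => N; rewrite normc_def; case: (_ - _).
have h2 : `|s - r N| < e / 2 by near: N; move/cvgrPdist_lt : rs; exact.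
have -> : l = (l - u N) + u N by rewrite subrK.
apply: le_trans (le_normcD _ _) _.
have := ur N; move: h2; rewrite ltr_norml => /andP[]; lra.
Unshelve. all: by end_near. Qed.

End ComplexLimits.

(** * Exponentials of Hermitian matrices *)

Section HermitianExponential.
Context (R : realType) (m : nat).
Local Notation C := (R[i] : numFieldType).
Implicit Types (A U : 'M[R[i]]_m) (d : 'I_m -> R).
Local Open Scope classical_set_scope.

Definition adjmx A : 'M[R[i]]_m := map_mx (@conjc R) A^T.

Definition rdiag d : 'M[R[i]]_m := diag_mx (\row_j real_complex R (d j)).

Definition unitary_mx U := U *m adjmx U = 1%:M.

Lemma unitary_mxV U : unitary_mx U -> adjmx U *m U = 1%:M.
Proof. exact: mulmx1C. Qed.

Definition diagonalizes U d A := unitary_mx U /\ A = adjmx U *m rdiag d *m U.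

Lemma hermitian_diagonalizable A : is_hermitian_op A -> exists U d, diagonalizes U d A.
Proof.
move=> Ah.
have hA : A \is hermsymmx.
  by apply/is_hermitianmxP; rewrite expr0 scale1r [LHS]Ah; apply/matrixP => i j; rewrite !mxE.
have An := hermitian_normalmx hA.
have Ur := spectral_unitarymx A.
exists (spectralmx A), (fun j => complex.Re (spectral_diag A ord0 j)); split.
  by have /unitarymxP := Ur.
have AE := elimT (@orthomx_spectralP _ _ A) An.
have real_d := hermitian_spectral_diag_real hA.
have E1 : invmx (spectralmx A) = adjmx (spectralmx A) by exact: invmx_unitary Ur.
have E2 : \row_j real_complex R (complex.Re (spectral_diag A ord0 j)) = spectral_diag A.
  apply/matrixP => i j; rewrite mxE (ord1 i).
  have /mxOverP /(_ ord0 j) dj := real_d.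
  exact: RRe_real dj.
by rewrite /rdiag E2 -E1.
Qed.

Lemma diagonalizesX U d A k : diagonalizes U d A ->
  A ^+ k = adjmx U *m rdiag (fun j => d j ^+ k) *m U.
Proof.
move=> [Uu ->]; elim: k => [|k IH].
  rewrite expr0 -[LHS]/1%:M -(unitary_mxV Uu); congr (_ *m U).
  rewrite -[LHS]mulmx1; congr (_ *m _); apply/matrixP => i j.
  by rewrite !mxE expr0 rmorph1.
rewrite exprS IH -[LHS]/(_ *m _) !mulmxA -[_ *m U *m adjmx U]mulmxA Uu mulmx1.
congr (_ *m U); rewrite -mulmxA; congr (_ *m _).
rewrite mulmx_diag; congr diag_mx; apply/matrixP => i j.
by rewrite !mxE exprS rmorphM.
Qed.

Lemma diagonalizesZ U d A (c : R) : diagonalizes U d A ->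
  diagonalizes U (fun j => c * d j) (real_complex R c *: A).
Proof.
move=> [Uu ->]; split => //; rewrite scalemxAl scalemxAr; congr (_ *m _ *m _).
by apply/matrixP => i j; rewrite !mxE mulrnAr rmorphM.
Qed.

(** Partial sums of the series defining [mexp A]; supports and norm bounds are established here and
    passed to the limit. *)
Definition texp A : nat -> 'M[R[i]]_m :=
  series (fun k => (k`!)%:R^-1 *: A ^+ k : 'M[C]_m).

Lemma mexp_diagonalizes_cvg U d A : diagonalizes U d A ->
  mxcvg (K := C) (texp A) (adjmx U *m rdiag (fun j => expR (d j)) *m U).
Proof.
move=> Ud.
have -> : texp A = fun N => adjmx U *m rdiag (fun j => series (exp_coeff (d j)) N) *m U.
  apply/funext => N; rewrite /texp /series /=.
  transitivity (adjmx U *m (\sum_(0 <= k < N) rdiag (fun j => exp_coeff (d j) k)) *m U).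
    rewrite mulmx_sumr mulmx_suml; apply: eq_bigr => k _.
    rewrite (diagonalizesX k Ud) scalemxAl scalemxAr; congr (_ *m _ *m _).
    apply/matrixP => i j; rewrite !mxE mulrnAr; congr (_ *+ _).
    by rewrite /exp_coeff /= rmorphM fmorphV rmorph_nat mulrC.
  congr (_ *m _ *m _); apply/matrixP => i j; rewrite summxE !mxE rmorph_sum /= -sumrMnl.
  by apply: eq_bigr => k _; rewrite !mxE.
apply: mxcvg_mul; last exact: mxcvg_cst.
apply: mxcvg_mul; first exact: mxcvg_cst.
move=> i j; rewrite !mxE; under eq_fun do rewrite !mxE.
case: (i == j); last by rewrite mulr0n; under eq_fun do rewrite mulr0n; exact: cvg_cst.
rewrite mulr1n; under eq_fun do rewrite mulr1n.
by apply: cvg_real_complex; exact: is_cvg_series_exp_coeff.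
Qed.

Lemma mexp_diagonalizes U d A : diagonalizes U d A ->
  mexp A = adjmx U *m rdiag (fun j => expR (d j)) *m U.
Proof. by move=> /mexp_diagonalizes_cvg; exact: mxcvg_lim. Qed.

Lemma texp_cvg A (c : R) : is_hermitian_op A ->
  mxcvg (K := C) (texp (real_complex R c *: A)) (mexp (real_complex R c *: A)).
Proof.
move=> /hermitian_diagonalizable[U [d Ud]]; have cUd := diagonalizesZ c Ud.
by rewrite (mexp_diagonalizes cUd); exact: mexp_diagonalizes_cvg.
Qed.

End HermitianExponential.

(** The triangle holds the pairs with [i + j < N], summed along antidiagonals; the rest of the
    square has [i + j >= N]. *)
Lemma big_square_triangle (V : zmodType) (F : nat -> nat -> V) N :
  \sum_(0 <= i < N) \sum_(0 <= j < N) F i j - \sum_(0 <= k < N) \sum_(i < k.+1) F (k - i)%N i =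
  \sum_(0 <= i < N) \sum_(N - i <= j < N) F i j.
Proof.
apply/eqP; rewrite subr_eq; apply/eqP.
have -> : \sum_(0 <= k < N) \sum_(i < k.+1) F (k - i)%N i =
    \sum_(0 <= i < N) \sum_(0 <= j < N - i) F i j.
  elim: N => [|N IH]; first by rewrite !big_geq.
  rewrite big_nat_recr //= IH [RHS]big_nat_recr //= subSnn big_nat1.
  have -> : \sum_(0 <= i < N) \sum_(0 <= j < N.+1 - i) F i j =
      \sum_(0 <= i < N) (\sum_(0 <= j < N - i) F i j + F i (N - i)%N).
    by apply: eq_big_nat => i /andP[_ iN]; rewrite (subSn (ltnW iN)) big_nat_recr.
  rewrite big_split /= -addrA; congr (_ + _).
  rewrite (reindex_inj rev_ord_inj) /= big_ord_recr /= subnn subn0 big_mkord.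
  congr (_ + _); apply: eq_bigr => i _.
  have iN := ltnW (ltn_ord i).
  by rewrite subSS subKn // .
rewrite -big_split /=; apply: eq_big_nat => i /andP[_ iN].
by rewrite addrC -big_cat_nat ?leq_subr.
Qed.

Lemma inv_fact_bin (K : numFieldType) k i : (i <= k)%N ->
  (k`!)%:R^-1 * 'C(k, i)%:R = ((k - i)`!)%:R^-1 * (i`!)%:R^-1 :> K.
Proof.
move=> ik; have f0 n : (n`!)%:R != 0 :> K by rewrite pnatr_eq0 -lt0n fact_gt0.
by rewrite -(bin_fact ik) !natrM; field; rewrite !f0 pnatr_eq0 -lt0n bin_gt0 ik.
Qed.

(** * Exponential of a sum of commuting matrices *)

Section ExponentialOfSum.
Context (R : realType) (m : nat).
Local Notation C := (R[i] : numFieldType).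
Local Notation normc := (@Normc.normc R).
Implicit Types (A B : 'M[R[i]]_m).
Local Open Scope classical_set_scope.

Lemma texp_add A B N : A *m B = B *m A ->
  texp A N *m texp B N - texp (A + B) N =
  \sum_(0 <= i < N) \sum_(N - i <= j < N)
    ((i`!)%:R^-1 * (j`!)%:R^-1) *: (A ^+ i *m B ^+ j).
Proof.
move=> AB; rewrite -big_square_triangle; congr (_ - _).
  rewrite /texp /series /= mulmx_suml; apply: eq_bigr => i _.
  by rewrite mulmx_sumr; apply: eq_bigr => j _; rewrite -scalemxAl -scalemxAr scalerA.
rewrite /texp /series /=; apply: eq_bigr => k _.
have cAB : GRing.comm A B by [].
rewrite (exprDn_comm _ cAB) scaler_sumr; apply: eq_bigr => i _.
have ik : (i <= k)%N by exact: ltn_ord i.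
by rewrite -(@inv_fact_bin C _ _ ik) -scalerA scaler_nat.
Qed.

Lemma exp_series_add (a b : R) N :
  series (exp_coeff a) N * series (exp_coeff b) N - series (exp_coeff (a + b)) N =
  \sum_(0 <= i < N) \sum_(N - i <= j < N) (i`!)%:R^-1 * (j`!)%:R^-1 * (a ^+ i * b ^+ j).
Proof.
rewrite -big_square_triangle; congr (_ - _).
  rewrite /series /= mulr_suml; apply: eq_bigr => i _.
  by rewrite mulr_sumr; apply: eq_bigr => j _; rewrite /exp_coeff /=; ring.
rewrite /series /=; apply: eq_bigr => k _; rewrite /exp_coeff /=.
rewrite exprDn mulr_suml; apply: eq_bigr => i _.
have ik : (i <= k)%N by exact: ltn_ord i.
by rewrite -(@inv_fact_bin R _ _ ik) -mulr_natr; ring.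
Qed.

Lemma normc_inv_fact k : normc ((k`!)%:R^-1) = (k`!)%:R^-1.
Proof. by rewrite Normc.normcV -(rmorph_nat (real_complex R)) normc_real normr_nat. Qed.

(** The matrix and scalar remainders are the same sum over [i, j < N <= i + j] with nonnegative
    coefficients, so they compare term by term. The scalar one tends to 0, which yields [mexpD]. *)
Lemma texp_add_opnorm A B N : A *m B = B *m A ->
  opnorm (texp A N *m texp B N - texp (A + B) N) <=
  series (exp_coeff (opnorm A)) N * series (exp_coeff (opnorm B)) N -
  series (exp_coeff (opnorm A + opnorm B)) N.
Proof.
move=> AB; rewrite texp_add // exp_series_add.
apply: le_trans (opnorm_sum _ _ _) _; apply: ler_sum => i _.
apply: le_trans (opnorm_sum _ _ _) _; apply: ler_sum => j _.
apply: le_trans (opnormZ _ _) _; rewrite Normc.normcM !normc_inv_fact.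
rewrite ler_wpM2l ?mulr_ge0 ?invr_ge0 //.
apply: le_trans (opnormM _ _) _.
by rewrite ler_pM ?opnorm_ge0 ?opnormX.
Qed.

Lemma mexpD A B : A *m B = B *m A ->
  mxcvg (K := C) (texp A) (mexp A) -> mxcvg (K := C) (texp B) (mexp B) ->
  mxcvg (K := C) (texp (A + B)) (mexp (A + B)) ->
  mexp (A + B) = mexp A *m mexp B.
Proof.
move=> AB cA cB cAB; apply/eqP; rewrite eq_sym -subr_eq0; apply/eqP/matrixP => i j.
have cvgE (x : R) : series (exp_coeff x) @ \oo --> expR x by exact: is_cvg_series_exp_coeff.
rewrite [RHS]mxE; apply: Normc.eq0_normc; apply/eqP; rewrite eq_le normc_ge0 andbT.
apply: (normc_cvg_le (u := fun N => (texp A N *m texp B N - texp (A + B) N) i j)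
  (r := fun N => series (exp_coeff (opnorm A)) N * series (exp_coeff (opnorm B)) N -
     series (exp_coeff (opnorm A + opnorm B)) N)).
- by move=> N; apply: le_trans (normc_le_opnorm _ _ _) (texp_add_opnorm _ AB).
- have hM : mxcvg (K := C) _ _ := mxcvgB (mxcvg_mul cA cB) cAB.
  exact: hM.
- rewrite -(subrr (expR (opnorm A) * expR (opnorm B))) -{2}expRD.
  by apply: cvgB (cvgE _); exact: cvgM.
Qed.

End ExponentialOfSum.

(** * Operators supported on a set of sites *)

Section LocalOperators.
Context (R : realType) (n d : nat).
Implicit Types (A B : qop R n d) (X Y : {set 'I_n}) (s t r : cfg n d).
Local Notation C := (R[i] : numFieldType).

Lemma meltM A B s t : melt (A *m B) s t = \sum_r melt A s r * melt B r t.
Proof.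
rewrite /melt mxE (reindex (@enum_rank (cfg n d))) //=.
by exists enum_val => i _; [exact: enum_rankK|exact: enum_valK].
Qed.

Lemma mxtrace_melt A : \tr A = \sum_s melt A s s.
Proof.
rewrite /mxtrace (reindex (@enum_rank (cfg n d))) //=.
by exists enum_val => i _; [exact: enum_rankK|exact: enum_valK].
Qed.

Lemma melt_inj A B : (forall s t, melt A s t = melt B s t) -> A = B.
Proof.
move=> AB; apply/matrixP => i j.
by have := AB (enum_val i) (enum_val j); rewrite /melt !enum_valK.
Qed.

Lemma supported_on0 X : supported_on X (0 : qop R n d).
Proof. by split=> *; rewrite /melt !mxE. Qed.

Lemma supported_on1 X : supported_on X (1%:M : qop R n d).
Proof.
split=> [s t [v [vX st]]|s t s' t' on_X st st'].
  rewrite /melt mxE; case: eqP => // /enum_rank_inj e.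
  by case: st; rewrite e.
rewrite /melt !mxE !(inj_eq enum_rank_inj).
congr (_ *+ (nat_of_bool _)); apply/eqP/eqP => e; apply/ffunP => v;
  have [vX|vX] := boolP (v \in X).
- by have [<- <-] := on_X v vX; rewrite e.
- exact: st'.
- by have [-> ->] := on_X v vX; rewrite e.
- exact: st.
Qed.

Lemma supported_onD X A B : supported_on X A -> supported_on X B -> supported_on X (A + B).
Proof.
move=> [A1 A2] [B1 B2]; split=> [s t st|s t s' t' on_X st st']; rewrite /melt !mxE.
  by have := A1 s t st; have := B1 s t st; rewrite /melt => -> ->; rewrite addr0.
by have := A2 s t s' t' on_X st st'; have := B2 s t s' t' on_X st st'; rewrite /melt => -> ->.
Qed.

Lemma supported_onZ X c A : supported_on X A -> supported_on X (c *: A).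
Proof.
move=> [A1 A2]; split=> [s t st|s t s' t' on_X st st']; rewrite /melt !mxE.
  by have := A1 s t st; rewrite /melt => ->; rewrite mulr0.
by have := A2 s t s' t' on_X st st'; rewrite /melt => ->.
Qed.

Lemma supported_on_sum X (J : Type) (r : seq J) (P : pred J) (F : J -> qop R n d) :
  (forall j, P j -> supported_on X (F j)) -> supported_on X (\sum_(j <- r | P j) F j).
Proof.
move=> FX; elim/big_rec: _ => [|j A Pj AX]; first exact: supported_on0.
exact: supported_onD (FX j Pj) AX.
Qed.

Lemma supported_onM X A B : supported_on X A -> supported_on X B -> supported_on X (A *m B).
Proof.
move=> [A1 A2] [B1 B2]; split=> [s t [v [vX st]]|s t s' t' on_X st st']; rewrite !meltM.
  apply: big1 => r _; have [sr|sr] := eqVneq (s v) (r v).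
    by rewrite [melt B r t]B1 ?mulr0 //; exists v; split=> //; rewrite -sr.
  by rewrite A1 ?mul0r //; exists v; split=> //; apply/eqP.
(* [g] exchanges the values of [s] and [s'] outside [X]. *)
pose g r : cfg n d := [ffun v => if v \in X then r v else tperm (s v) (s' v) (r v)].
have gK : involutive g.
  by move=> r; apply/ffunP => v; rewrite !ffunE; case: (v \in X) => //; rewrite tpermK.
rewrite [RHS](reindex_inj (inv_inj gK)) /=; apply: eq_bigr => r _.
(* A configuration [r] that differs from [s] outside [X] contributes 0 on both sides. *)
have [/forallP sr|] := boolP [forall v, (v \notin X) ==> (s v == r v)].
  have sr' v : v \notin X -> s v = r v by move=> vX; exact/eqP/(implyP (sr v)).
  have gE v : v \notin X -> g r v = s' v.
    by move=> vX; rewrite ffunE (negbTE vX) -sr' // tpermL.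
  congr (_ * _); [apply: A2|apply: B2] => // v vX.
  - by rewrite ffunE vX; have [-> _] := on_X v vX.
  - by rewrite gE.
  - by rewrite ffunE vX; have [_ ->] := on_X v vX.
  - by rewrite -sr' // st.
  - by rewrite gE // st'.
rewrite negb_forall => /existsP[v]; rewrite negb_imply => /andP[vX /eqP svr].
rewrite A1 ?mul0r ?[melt A s' _]A1 ?mul0r //; exists v; split=> //.
rewrite ffunE (negbTE vX) => e; apply: svr.
by apply: (@perm_inj _ (tperm (s v) (s' v))); rewrite -e tpermL.
Qed.

Lemma supported_onX X A k : supported_on X A -> supported_on X (A ^+ k).
Proof.
move=> AX; elim: k => [|k IH]; first exact: supported_on1.
by rewrite exprS; exact: supported_onM.
Qed.

Lemma supported_on_sub X Y A : X \subset Y -> supported_on X A -> supported_on Y A.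
Proof.
move=> /fintype.subsetP XY [A1 A2]; split=> [s t [v [vY st]]|s t s' t' on_Y st st'].
  by apply: A1; exists v; split=> //; apply: contra vY; exact: XY.
have [/forallP eq_st|] := boolP [forall v, (v \notin X) ==> (s v == t v)].
  have st1 v : v \notin X -> s v = t v by move=> vX; exact/eqP/(implyP (eq_st v)).
  apply: A2 => // v vX; first by apply: on_Y; exact: XY.
  have [vY|vY] := boolP (v \in Y); last exact: st'.
  by have [<- <-] := on_Y v vY; exact: st1.
rewrite negb_forall => /existsP[v]; rewrite negb_imply => /andP[vX /eqP svt].
rewrite A1 ?[melt A s' _]A1 //; exists v; split=> //.
have [vY|vY] := boolP (v \in Y); last by case: svt; exact: st.
by have [<- <-] := on_Y v vY.
Qed.

Lemma supported_on_lim X (u : nat -> qop R n d) A : (forall N, supported_on X (u N)) ->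
  mxcvg (K := C) u A -> supported_on X A.
Proof.
move=> uX uA; split=> [s t st|s t s' t' on_X st st'].
  have := uA (enum_rank s) (enum_rank t).
  have -> : (fun N => u N (enum_rank s) (enum_rank t) : C) = fun=> 0.
    by apply/funext => N; exact: (proj1 (uX N) s t st).
  by move=> h; exact: (cvg_unique (@norm_hausdorff _ C) h (cvg_cst _)).
have := uA (enum_rank s) (enum_rank t).
have -> : (fun N => u N (enum_rank s) (enum_rank t) : C) =
    fun N => u N (enum_rank s') (enum_rank t').
  by apply/funext => N; exact: (proj2 (uX N) s t s' t' on_X st st').
by move=> h; exact: (cvg_unique (@norm_hausdorff _ C) h (uA _ _)).
Qed.

Lemma supported_on_mexp X A : supported_on X A -> mxcvg (K := C) (texp A) (mexp A) ->
  supported_on X (mexp A).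
Proof.
move=> AX; apply: supported_on_lim => N; apply: supported_on_sum => k _.
by apply: supported_onZ; exact: supported_onX.
Qed.

Definition splice X s t : cfg n d := [ffun v => if v \in X then s v else t v].

(** [A] changes only sites of [X] and [B] only sites of [Y], so a single intermediate configuration
    survives in each product: [splice X t s] for [A *m B] and [splice X s t] for [B *m A]. *)
Lemma supported_on_comm X Y A B : [disjoint X & Y] ->
  supported_on X A -> supported_on Y B -> A *m B = B *m A.
Proof.
move=> XY [A1 A2] [B1 B2]; have YX v : v \in Y -> v \notin X.
  by move=> vY; apply: contraL XY => vX; apply/pred0Pn; exists v; rewrite /= vX.
apply: melt_inj => s t; rewrite !meltM.
have eA r : r != splice X t s -> melt A s r * melt B r t = 0.
  move=> rE; have [v] : exists v, r v != splice X t s v.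
    apply/existsP; rewrite -negb_forall; apply: contra rE => /forallP e.
    by apply/eqP/ffunP => v; exact/eqP.
  rewrite ffunE; case: ifP => vX rv.
    rewrite [melt B r t]B1 ?mulr0 //; exists v; split; last exact/eqP.
    by apply: contraL vX; exact: YX.
  by rewrite A1 ?mul0r //; exists v; rewrite vX; split=> //; apply/eqP; rewrite eq_sym.
have eB r : r != splice X s t -> melt B s r * melt A r t = 0.
  move=> rE; have [v] : exists v, r v != splice X s t v.
    apply/existsP; rewrite -negb_forall; apply: contra rE => /forallP e.
    by apply/eqP/ffunP => v; exact/eqP.
  rewrite ffunE; case: ifP => vX rv.
    rewrite [melt B s r]B1 ?mul0r //; exists v; split; last by apply/eqP; rewrite eq_sym.
    by apply: contraL vX; exact: YX.
  by rewrite [melt A r t]A1 ?mulr0 //; exists v; rewrite vX; split=> //; exact/eqP.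
rewrite (bigD1 (splice X t s)) //= big1 ?addr0; last by move=> r; exact: eA.
rewrite [RHS](bigD1 (splice X s t)) //= big1 ?addr0; last by move=> r; exact: eB.
have [/forallP st|] := boolP [forall v, (v \notin X :|: Y) ==> (s v == t v)].
  have st1 v : v \notin X -> v \notin Y -> s v = t v.
    by move=> vX vY; apply/eqP/(implyP (st v)); rewrite inE negb_or vX.
  rewrite mulrC; congr (_ * _).
    apply: B2 => v vY; rewrite !ffunE; first by rewrite (negbTE (YX v vY)).
      by case: ifP => // /negbT vX; exact: st1.
    by case: ifP => // /negbT vX; exact: st1.
  by apply: A2 => v vX; rewrite !ffunE ?vX ?(negbTE vX).
rewrite negb_forall => /existsP[v]; rewrite negb_imply inE negb_or => /andP[/andP[vX vY] /eqP svt].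
rewrite [melt B _ t]B1 ?mulr0 ?[melt B s _]B1 ?mul0r //; exists v; split=> //;
  by rewrite ffunE (negbTE vX).
Qed.

(** The normalised trace is multiplicative. A diagonal entry of [A *m B] is [A_ss * B_ss], since an
    intermediate [r] differing from [s] in [X] kills [B] and one differing elsewhere kills [A]; the
    two entries then depend on disjoint sets of sites. *)
Lemma mxtrace_supported_mul X Y A B : [disjoint X & Y] ->
  supported_on X A -> supported_on Y B -> (hdim n d)%:R * \tr (A *m B) = \tr A * \tr B.
Proof.
move=> XY [A1 A2] [B1 B2]; have XYn v : v \in X -> v \notin Y.
  by move=> vX; apply: contraL XY => vY; apply/pred0Pn; exists v; rewrite /= vX.
rewrite !mxtrace_melt mulr_suml.
have -> : \sum_s melt (A *m B) s s = \sum_s melt A s s * melt B s s.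
  apply: eq_bigr => s _; rewrite meltM (bigD1 s) //= big1 ?addr0 // => r rs.
  have [v] : exists v, r v != s v.
    apply/existsP; rewrite -negb_forall; apply: contra rs => /forallP e.
    by apply/eqP/ffunP => v; exact/eqP.
  move=> rv; have [vX|vX] := boolP (v \in X).
    by rewrite [melt B r s]B1 ?mulr0 //; exists v; split; [exact: XYn|exact/eqP].
  by rewrite A1 ?mul0r //; exists v; split=> //; apply/eqP; rewrite eq_sym.
transitivity (\sum_s \sum_t melt A s s * melt B t t); last first.
  by apply: eq_bigr => s _; rewrite mulr_sumr.
(* [g] exchanges the restrictions to [X] of two configurations. *)
pose g (p : cfg n d * cfg n d) := (splice X p.1 p.2, splice X p.2 p.1).
have gK : involutive g.
  by move=> [s t]; congr (_, _); apply/ffunP => v; rewrite !ffunE; case: (v \in X).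
rewrite pair_big /= (reindex_inj (inv_inj gK)) /=.
rewrite (eq_bigr (fun p => melt A p.1 p.1 * melt B p.1 p.1)); last first.
  move=> [s t] _ /=; congr (_ * _); [apply: A2|apply: B2] => // v vX; rewrite !ffunE ?vX //.
  by rewrite ifN //; apply: contraL vX; exact: XYn.
rewrite -(pair_big predT predT (fun s t => melt A s s * melt B s s)) /= mulr_sumr.
by apply: eq_bigr => s _; rewrite sumr_const mulr_natl.
Qed.

End LocalOperators.

(** * Moebius transforms of set functions *)

Section MobiusInversion.
Context (I : finType).
Implicit Types (A B C E : {set I}).

Lemma altsum_mobius (W : pzRingType) (Phi w : {set I} -> W) C E :
  (forall A, Phi A = \sum_(B : {set I} | B \subset A) w B) -> [disjoint C & E] ->
  altsum Phi C E = \sum_(B : {set I} | B \subset E) w (C :|: B).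
Proof.
move=> PhiE; elim/set_ind_setU1: C E => [|X C XC IH] E.
  by move=> _; rewrite altsum0 PhiE; apply: eq_bigr => B _; rewrite finset.set0U.
rewrite disjointsU disjoints1 => /andP[XE CE].
have := altsum_setU1 Phi E XC.
rewrite addrC => /eqP; rewrite -subr_eq => /eqP <-.
rewrite !IH //; last first.
  by rewrite disjoint_sym disjointsU disjoints1 XC disjoint_sym.
rewrite (big_subsetU1 _ XE) [X in X - _]addrC addrK; apply: eq_bigr => B _.
by rewrite finset.setUCA finset.setUA.
Qed.

Lemma altsum_mobius0 (W : pzRingType) (Phi w : {set I} -> W) C :
  (forall A, Phi A = \sum_(B : {set I} | B \subset A) w B) ->
  altsum Phi C finset.set0 = w C.
Proof.
move=> PhiE; rewrite (altsum_mobius PhiE); last by rewrite -setI_eq0 finset.setI0.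
rewrite (eq_bigl (pred1 finset.set0)) => [|A]; last by rewrite finset.subset0.
by rewrite big_pred1_eq finset.setU0.
Qed.

(** Each bond of [C] takes one difference of the exponential, which produces the factor
    [expR (t X) - 1]: the weight of an occurring bond. *)
Lemma altsum_expR (R : realType) (t : I -> R) C E : [disjoint C & E] ->
  altsum (fun A => expR (\sum_(X in A) t X)) C E =
  expR (\sum_(X in E) t X) * \prod_(X in C) (expR (t X) - 1).
Proof.
elim/set_ind_setU1: C E => [|X C XC IH] E; first by rewrite altsum0 big_set0 mulr1.
rewrite disjointsU disjoints1 => /andP[XE CE].
have := altsum_setU1 (fun A => expR (\sum_(X in A) t X)) E XC.
rewrite addrC => /eqP; rewrite -subr_eq => /eqP <-.
rewrite !IH //; last first.
  by rewrite disjoint_sym disjointsU disjoints1 XC disjoint_sym.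
by rewrite !big_setU1 //= expRD; ring.
Qed.

End MobiusInversion.

(** * Comparison of matrix-valued with scalar set functions *)

Section Domination.
Context (R : realType) (m : nat) (I : finType).
Implicit Types (A B C : {set I}) (Phi Psi : {set I} -> 'M[R[i]]_m) (phi psi : {set I} -> R).

(* The Moebius transform of [Phi] is bounded in operator norm by that of [phi]. *)
Definition dominated Phi phi : Prop := exists w z,
  [/\ forall A, Phi A = \sum_(B : {set I} | B \subset A) w B,
      forall A, phi A = \sum_(B : {set I} | B \subset A) z B &
      forall B, opnorm (w B) <= z B :> R].

Lemma dominated_ext Phi phi Psi psi : Phi =1 Psi -> phi =1 psi ->
  dominated Phi phi -> dominated Psi psi.
Proof.
move=> eP ep [w [z [Pw pz wz]]]; exists w, z.
by split=> // A; rewrite -?eP -?ep.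
Qed.

Lemma dominated_cst (M : 'M[R[i]]_m) c : opnorm M <= c -> dominated (fun=> M) (fun=> c).
Proof.
move=> Mc; have e0 (W : nmodType) (x : W) A :
    x = \sum_(B : {set I} | B \subset A) if B == finset.set0 then x else 0.
  rewrite (bigD1 finset.set0) ?finset.sub0set //= eqxx big1 ?addr0 // => B /andP[_ /negbTE ->] //.
exists (fun B => if B == finset.set0 then M else 0), (fun B => if B == finset.set0 then c else 0).
by split=> [A|A|B]; [exact: e0|exact: e0|case: ifP => //; rewrite opnorm0].
Qed.

Lemma dominatedD Phi phi Psi psi : dominated Phi phi -> dominated Psi psi ->
  dominated (fun A => Phi A + Psi A) (fun A => phi A + psi A).
Proof.
move=> [w [z [Pw pz wz]]] [w' [z' [Pw' pz' wz']]].
exists (fun B => w B + w' B), (fun B => z B + z' B); split=> [A|A|B].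
- by rewrite Pw Pw' big_split.
- by rewrite pz pz' big_split.
- by apply: le_trans (opnormD _ _) _; rewrite lerD.
Qed.

(** The transform of a product at [B] sums [w p.1 *m w' p.2] over the pairs with union [B], and the
    operator norm is submultiplicative in each term. *)
Lemma dominatedM Phi phi Psi psi : dominated Phi phi -> dominated Psi psi ->
  dominated (fun A => Phi A *m Psi A) (fun A => phi A * psi A).
Proof.
move=> [w [z [Pw pz wz]]] [w' [z' [Pw' pz' wz']]].
have sumU (W : nmodType) (F : {set I} -> {set I} -> W) A :
    \sum_(B : {set I} | B \subset A) \sum_(p : {set I} * {set I} | p.1 :|: p.2 == B) F p.1 p.2 =
    \sum_(B : {set I} | B \subset A) \sum_(D : {set I} | D \subset A) F B D.
  rewrite (exchange_big_dep predT) //= [RHS]pair_big_dep /= [RHS]big_mkcond /=.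
  apply: eq_bigr => -[B D] _ /=.
  rewrite (eq_bigl (fun S : {set I} => (S == B :|: D) && (B :|: D \subset A))); last first.
    by move=> S; rewrite andbC eq_sym; case: eqP => //= ->.
  rewrite finset.subUset; case: (_ && _); last by rewrite big_pred0 // => S; rewrite andbF.
  by rewrite (eq_bigl (pred1 (B :|: D))) ?big_pred1_eq // => S; rewrite andbT.
exists (fun B => \sum_(p : {set I} * {set I} | p.1 :|: p.2 == B) w p.1 *m w' p.2).
exists (fun B => \sum_(p : {set I} * {set I} | p.1 :|: p.2 == B) z p.1 * z' p.2).
split=> [A|A|B].
- rewrite (sumU _ (fun B D => w B *m w' D)) Pw Pw' mulmx_suml; apply: eq_bigr => B _.
  by rewrite mulmx_sumr.
- rewrite (sumU _ (fun B D => z B * z' D)) pz pz' mulr_suml; apply: eq_bigr => B _.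
  by rewrite mulr_sumr.
- apply: le_trans (opnorm_sum _ _ _) _; apply: ler_sum => p _.
  by apply: le_trans (opnormM _ _) _; rewrite ler_pM ?opnorm_ge0.
Qed.

Lemma dominatedX Phi phi k : dominated Phi phi ->
  dominated (fun A => Phi A ^+ k) (fun A => phi A ^+ k).
Proof.
move=> dP; elim: k => [|k IH]; first exact: dominated_cst (opnorm1 _ _).
by apply: dominated_ext (dominatedM dP IH) => A; rewrite exprS.
Qed.

(** The transform of an additive set function lives on singletons. *)
Lemma dominated_linear (a : I -> 'M[R[i]]_m) (t : I -> R) : (forall X, opnorm (a X) <= t X) ->
  dominated (fun A => \sum_(X in A) a X) (fun A => \sum_(X in A) t X).
Proof.
move=> at_le; have e1 (W : nmodType) (x : I -> W) A :
    \sum_(X in A) x X = \sum_(B : {set I} | B \subset A) \sum_(X | [set X] == B) x X.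
  rewrite (exchange_big_dep predT) //= big_mkcond /=; apply: eq_bigr => X _.
  rewrite (eq_bigl (fun S : {set I} => (S == [set X]) && (X \in A))); last first.
    by move=> S; rewrite andbC eq_sym; case: eqP => //= ->; rewrite finset.sub1set.
  case: (X \in A); last by rewrite big_pred0 // => S; rewrite andbF.
  by rewrite (eq_bigl (pred1 [set X])) ?big_pred1_eq // => S; rewrite andbT.
exists (fun B => \sum_(X | [set X] == B) a X), (fun B => \sum_(X | [set X] == B) t X).
split=> [A|A|B]; [exact: e1|exact: e1|].
by apply: le_trans (opnorm_sum _ _ _) _; apply: ler_sum.
Qed.

Lemma dominated_sum (r : seq nat) (Phi : nat -> {set I} -> 'M[R[i]]_m)
    (phi : nat -> {set I} -> R) : (forall k, dominated (Phi k) (phi k)) ->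
  dominated (fun A => \sum_(k <- r) Phi k A) (fun A => \sum_(k <- r) phi k A).
Proof.
move=> dP; elim: r => [|k r IH].
  apply: (@dominated_ext (fun=> 0) (fun=> 0)) => [A|A|]; rewrite ?big_nil //.
  by apply: dominated_cst; rewrite opnorm0.
by apply: dominated_ext (dominatedD (dP k) IH) => A; rewrite big_cons.
Qed.

Lemma dominated_texp Phi phi N : dominated Phi phi ->
  dominated (fun A => texp (Phi A) N) (fun A => series (exp_coeff (phi A)) N).
Proof.
move=> dP; apply: dominated_sum => k.
have c : opnorm (((k`!)%:R^-1 : R[i])%:M : 'M[R[i]]_m) <= (k`!)%:R^-1 :> R.
  rewrite -scalemx1; apply: le_trans (opnormZ _ _) _; rewrite normc_inv_fact.
  by rewrite ler_piMr ?opnorm1 // invr_ge0.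
apply: dominated_ext (dominatedM (dominated_cst c) (dominatedX k dP)) => A.
  by rewrite mul_scalar_mx.
by rewrite /exp_coeff /= mulrC.
Qed.

Lemma dominated_altsum (P : 'M[R[i]]_m) Phi phi C : dominated Phi phi ->
  Normc.normc (altsum (fun A => \tr (P *m Phi A)) C finset.set0) <=
  m%:R * opnorm P * altsum phi C finset.set0.
Proof.
move=> [w [z [Pw pz wz]]].
rewrite (altsum_mobius0 (w := fun B => \tr (P *m w B))) => [|A]; last first.
  by rewrite Pw mulmx_sumr raddf_sum.
rewrite (altsum_mobius0 _ pz) -mulrA; apply: le_trans (normc_mxtrace _) _.
rewrite ler_wpM2l //; apply: le_trans (opnormM _ _) _.
by rewrite ler_wpM2l ?opnorm_ge0.
Qed.

End Domination.

(** * Local Gibbs expectations *)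

Lemma mulmx_interleave (K : pzRingType) m (P Q F1 F2 H1 H2 : 'M[K]_m) :
  F2 *m H1 = H1 *m F2 -> Q *m (F1 *m H1) = F1 *m H1 *m Q ->
  P *m Q *m (F1 *m F2 *m (H1 *m H2)) = (P *m (F1 *m H1)) *m (Q *m (F2 *m H2)).
Proof.
move=> c1 c2; rewrite -[RHS]mulmxA -[P *m Q *m _]mulmxA; congr (_ *m _).
rewrite [RHS]mulmxA -c2 -mulmxA -[in RHS]mulmxA; congr (_ *m _).
by rewrite -!mulmxA [F2 *m (_ *m _)]mulmxA c1 -!mulmxA.
Qed.

Section LocalGibbs.
Context (R : realType) (n d : nat) (d_gt0 : (0 < d)%N).
Local Notation C := (R[i] : numFieldType).
Local Notation bonds := {set {set 'I_n}}.
Context (h f : {set 'I_n} -> qop R n d) (s b : R).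
Hypotheses (h_herm : forall X, is_hermitian_op (h X)) (f_herm : forall X, is_hermitian_op (f X)).
Hypotheses (h_supp : forall X, supported_on X (h X)) (f_supp : forall X, supported_on X (f X)).
Implicit Types (P Q : qop R n d) (E : bonds) (S : {set 'I_n}).

Definition bond_sum (a : {set 'I_n} -> qop R n d) E : qop R n d := \sum_(X in E) a X.

Definition bond_exp (c : R) a E : qop R n d := mexp (real_complex R c *: bond_sum a E).

Definition gibbs E : qop R n d := bond_exp s f E *m bond_exp b h E.

(** Not divided by the partition function, which is the value at [1%:M]; the factor [hdim^-1] makes
    it multiplicative over separated supports. *)
Definition gibbs_expect P E : R[i] := (hdim n d)%:R^-1 * \tr (P *m gibbs E).

Lemma hdim_gt0 : (0 < hdim n d)%N.
Proof. by apply/card_gt0P; exists [ffun=> Ordinal d_gt0]. Qed.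

Lemma bond_sum_hermitian a E : (forall X, is_hermitian_op (a X)) -> is_hermitian_op (bond_sum a E).
Proof.
move=> aH; rewrite /is_hermitian_op /bond_sum; apply/matrixP => i j.
rewrite !mxE !summxE rmorph_sum; apply: eq_bigr => X _.
by rewrite {1}(aH X) !mxE.
Qed.

Lemma bond_sum_supported a E S : (forall X, supported_on X (a X)) -> finset.cover E \subset S ->
  supported_on S (bond_sum a E).
Proof.
move=> aS ES; apply: supported_on_sum => X XE; apply: supported_on_sub (aS X).
by apply: fintype.subset_trans ES; exact: finset.bigcup_sup.
Qed.

Lemma bond_exp_supported c a E S : (forall X, is_hermitian_op (a X)) ->
  (forall X, supported_on X (a X)) -> finset.cover E \subset S -> supported_on S (bond_exp c a E).
Proof.
move=> aH aS ES; apply: supported_on_mexp; last exact: texp_cvg (bond_sum_hermitian _ aH).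
by apply: supported_onZ; exact: bond_sum_supported.
Qed.

Lemma bond_expU c a E1 E2 : (forall X, is_hermitian_op (a X)) ->
  (forall X, supported_on X (a X)) -> [disjoint E1 & E2] ->
  [disjoint finset.cover E1 & finset.cover E2] ->
  bond_exp c a (E1 :|: E2) = bond_exp c a E1 *m bond_exp c a E2.
Proof.
move=> aH aS dE dC; rewrite /bond_exp.
have sumU : bond_sum a (E1 :|: E2) = bond_sum a E1 + bond_sum a E2.
  by rewrite /bond_sum -bigU //=; apply: eq_bigl => X; rewrite inE.
have cvgE E := texp_cvg (c := c) (bond_sum_hermitian E aH).
have := cvgE (E1 :|: E2); rewrite sumU scalerDr => cU.
apply: (mexpD _ (cvgE E1) (cvgE E2) cU).
rewrite -!scalemxAl -!scalemxAr; congr (_ *: (_ *: _)).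
by apply: supported_on_comm dC _ _; exact: bond_sum_supported.
Qed.

Lemma gibbs_supported E S : finset.cover E \subset S -> supported_on S (gibbs E).
Proof. by move=> ES; apply: supported_onM; exact: bond_exp_supported. Qed.

(** Operators of the two regions commute, so the product regroups into one factor per region, and
    the normalised trace separates them. *)
Lemma gibbs_expect_split P Q S S' E1 E2 : supported_on S P -> supported_on S' Q ->
  [disjoint E1 & E2] -> [disjoint S :|: finset.cover E1 & S' :|: finset.cover E2] ->
  gibbs_expect (P *m Q) (E1 :|: E2) = gibbs_expect P E1 * gibbs_expect Q E2.
Proof.
move=> PS QS dE dS.
have sub1 : S \subset S :|: finset.cover E1 by exact: finset.subsetUl.
have sub2 : finset.cover E1 \subset S :|: finset.cover E1 by exact: finset.subsetUr.
have sub1' : S' \subset S' :|: finset.cover E2 by exact: finset.subsetUl.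
have sub2' : finset.cover E2 \subset S' :|: finset.cover E2 by exact: finset.subsetUr.
have dC : [disjoint finset.cover E1 & finset.cover E2].
  exact: disjointWl sub2 (disjointWr sub2' dS).
have eqG : P *m Q *m gibbs (E1 :|: E2) = (P *m gibbs E1) *m (Q *m gibbs E2).
  rewrite /gibbs (bond_expU s f_herm f_supp dE dC) (bond_expU b h_herm h_supp dE dC).
  apply: mulmx_interleave.
    apply: (@supported_on_comm _ _ _ (finset.cover E2) (finset.cover E1));
      [by rewrite disjoint_sym|exact: bond_exp_supported|exact: bond_exp_supported].
  apply: (@supported_on_comm _ _ _ S' (finset.cover E1)) => //.
    by rewrite disjoint_sym; exact: disjointWl sub2 (disjointWr sub1' dS).
  exact: (gibbs_supported (fintype.subxx _)).
have sPG : supported_on (S :|: finset.cover E1) (P *m gibbs E1).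
  by apply: supported_onM; [exact: supported_on_sub PS|exact: gibbs_supported].
have sQG : supported_on (S' :|: finset.cover E2) (Q *m gibbs E2).
  by apply: supported_onM; [exact: supported_on_sub QS|exact: gibbs_supported].
have := mxtrace_supported_mul dS sPG sQG; rewrite /gibbs_expect eqG => eqtr.
have D0 : (hdim n d)%:R != 0 :> R[i] by rewrite pnatr_eq0 -lt0n hdim_gt0.
by rewrite mulrACA -eqtr -mulrA mulKf.
Qed.

Definition bond_strength X : R := `|s| * opnorm (f X) + `|b| * opnorm (h X).

(** Partial sums of the matrix exponentials are [dominated] by those of scalar exponentials, for
    which [altsum_expR] evaluates the limit. The dimension from the trace bound cancels the
    normalisation. *)
Lemma gibbs_expect_altsum P E0 :
  Normc.normc (altsum (gibbs_expect P) E0 finset.set0) <=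
  opnorm P * \prod_(X in E0) (expR (bond_strength X) - 1).
Proof.
pose phi (c : R) (a : {set 'I_n} -> qop R n d) E : R := `|c| * \sum_(X in E) opnorm (a X).
have dom c a : dominated (fun E => real_complex R c *: bond_sum a E) (phi c a).
  have cM : opnorm ((real_complex R c)%:M : qop R n d) <= `|c|.
    rewrite -scalemx1; apply: le_trans (opnormZ _ _) _.
    by rewrite normc_real ler_piMr ?opnorm1.
  have lin : dominated (bond_sum a) (fun E => \sum_(X in E) opnorm (a X)).
    exact: dominated_linear.
  have dM := dominatedM (dominated_cst _ cM) lin.
  by apply: dominated_ext dM => E //; rewrite mul_scalar_mx.
pose psi N E := series (exp_coeff (phi s f E)) N * series (exp_coeff (phi b h E)) N.
pose Psi N E := texp (real_complex R s *: bond_sum f E) N *m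
                texp (real_complex R b *: bond_sum h E) N.
have bnd N := dominated_altsum P E0
  (dominatedM (dominated_texp N (dom s f)) (dominated_texp N (dom b h))).
have D0 : (0 : R) < (hdim n d)%:R by rewrite ltr0n hdim_gt0.
have D0C : (hdim n d)%:R != 0 :> R[i] by rewrite pnatr_eq0 -lt0n hdim_gt0.
have -> : altsum (gibbs_expect P) E0 finset.set0 =
    (hdim n d)%:R^-1 * altsum (fun E => \tr (P *m gibbs E)) E0 finset.set0.
  rewrite /altsum mulr_sumr; apply: eq_bigr => E _.
  by rewrite /gibbs_expect mulrCA.
have -> : Normc.normc ((hdim n d)%:R^-1 * altsum (fun E => \tr (P *m gibbs E)) E0 finset.set0) =
    (hdim n d)%:R^-1 * Normc.normc (altsum (fun E => \tr (P *m gibbs E)) E0 finset.set0).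
  by rewrite Normc.normcM Normc.normcV -(rmorph_nat (real_complex R)) normc_real normr_nat.
rewrite ler_pdivrMl // mulrA.
have -> : \prod_(X in E0) (expR (bond_strength X) - 1) =
    altsum (fun E => expR (phi s f E) * expR (phi b h E)) E0 finset.set0.
  have := altsum_expR bond_strength (C := E0) (E := finset.set0).
  rewrite -setI_eq0 finset.setI0 eqxx big_set0 expR0 mul1r => <- //.
  rewrite /altsum; apply: eq_bigr => E _; congr (_ * _).
  by rewrite -expRD /phi !mulr_sumr -big_split.
apply: (normc_cvg_le (r := fun N => (hdim n d)%:R * opnorm P * altsum (psi N) E0 finset.set0) bnd).
  apply: (cvg_altsum (K := C)) => E; apply: mxcvg_trace.
  apply: (mxcvg_mul (K := C)); first exact: mxcvg_cst.
  by apply: (mxcvg_mul (K := C)); apply: texp_cvg; exact: bond_sum_hermitian.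
apply: cvgM; first exact: cvg_cst.
apply: cvg_altsum => E.
by apply: cvgM; exact: is_cvg_series_exp_coeff.
Qed.

Lemma gibbs_expect_local P S : supported_on S P ->
  local_observable (fun X => expR (bond_strength X) - 1)
    (gibbs_expect 1%:M) (gibbs_expect P) S (opnorm P).
Proof.
move=> PS; split=> [E1 E2 dE dS|E]; last exact: gibbs_expect_altsum.
rewrite -{1}[P]mulmx1; apply: gibbs_expect_split PS (@supported_on1 _ _ _ finset.set0) dE _.
by rewrite finset.set0U.
Qed.

End LocalGibbs.

(** * Decay of correlations at high temperature *)

Section Constants.
Context (R : realType).

Lemma expR_eighth_le : expR (8^-1) <= 8 / 7 :> R.
Proof.
have := expR_ge1Dx (- 8^-1 : R); rewrite expRN => h.
have e0 := expR_gt0 (8^-1 : R).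
rewrite -[leLHS]invrK -[leRHS]invrK lef_pV2 ?posrE ?invr_gt0 ?divr_gt0 //.
by apply: le_trans h; lra.
Qed.

Lemma expR_eighths_le j : expR (j%:R / 8) <= (8 / 7) ^+ j :> R.
Proof.
rewrite expRM_natl.
by apply: lerXn2r; rewrite ?nnegrE ?expR_ge0 ?expR_eighth_le // divr_ge0.
Qed.

(** From [(1 - t) * expR t <= 1] and [1 - t >= 63 / 64]. *)
Lemma expR_sub1_le (t : R) : 0 <= t -> t <= 64^-1 -> expR t - 1 <= 64 / 63 * t.
Proof.
move=> t0 t1; have := expR_ge1Dx (- t); rewrite expRN => h.
have e0 := expR_gt0 t.
have : (1 - t) * expR t <= 1 by rewrite -ler_pdivlMr // div1r.
nra.
Qed.

End Constants.

(** * Covariances of the local terms of the perturbation *)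

Section GibbsCovariance.
Context (R : realType) (n d k : nat) (g s b : R) (h f : {set 'I_n} -> qop R n d).
Hypotheses (d_gt0 : (0 < d)%N) (k_gt0 : (0 < k)%N) (g_gt0 : 0 < g).
Hypotheses (h_herm : forall X, is_hermitian_op (h X)) (f_herm : forall X, is_hermitian_op (f X)).
Hypotheses (h_supp : forall X, supported_on X (h X)) (f_supp : forall X, supported_on X (f X)).
Hypothesis h_small : forall X : {set 'I_n}, (k < #|X|)%N -> h X = 0.
Hypothesis (f_small : forall X : {set 'I_n}, (k < #|X|)%N -> f X = 0).
Hypothesis h_vertex : forall v, \sum_(X : {set 'I_n} | v \in X) opnorm (h X) <= g.
Hypothesis f_vertex : forall v, \sum_(X : {set 'I_n} | v \in X) opnorm (f X) <= g.
Hypothesis small : (`|s| + `|b|) * g * k%:R <= 64^-1.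
Local Notation normc := (@Normc.normc R).

(* The cluster expansion is applied with A = e^(2u), B = e^u and K = e^(14u). *)
Let u : R := (8 * k%:R)^-1.
Let x (X : {set 'I_n}) : R := expR (bond_strength h f s b X) - 1.
Let strength_vertex v : \sum_(X : {set 'I_n} | v \in X) bond_strength h f s b X <= (64 * k%:R)^-1.
Proof.
have -> : \sum_(X : {set 'I_n} | v \in X) bond_strength h f s b X =
    `|s| * (\sum_(X : {set 'I_n} | v \in X) opnorm (f X)) +
    `|b| * (\sum_(X : {set 'I_n} | v \in X) opnorm (h X)).
  by rewrite !big_distrr /= -big_split.
apply: (@le_trans _ _ ((`|s| + `|b|) * g)).
  rewrite mulrDl.
  exact: lerD (ler_wpM2l (normr_ge0 s) (f_vertex v)) (ler_wpM2l (normr_ge0 b) (h_vertex v)).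
by rewrite invfM ler_pdivlMr ?ltr0n.
Qed.

Let strength_ge0 X : 0 <= bond_strength h f s b X.
Proof. by rewrite addr_ge0 // mulr_ge0 ?opnorm_ge0. Qed.

Let k_pos : 0 < k%:R :> R. Proof. by rewrite ltr0n. Qed.

Let x_ge0 X : 0 <= x X.
Proof. by rewrite subr_ge0 -expR0 ler_expR. Qed.

Let u_gt0 : 0 < u. Proof. by rewrite invr_gt0 mulr_gt0. Qed.

Let u_le : u <= 8^-1.
Proof. by rewrite /u invfM ler_piMr ?invr_ge0 // invf_le1 // ler1n. Qed.

Let card_u m : (m <= k)%N -> m%:R * u <= 8^-1.
Proof.
move=> mk; rewrite /u invfM mulrCA ler_piMr ?invr_ge0 // ler_pdivrMr // mul1r.
by rewrite ler_nat.
Qed.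

Let x_le (X : {set 'I_n}) v : v \in X -> x X <= 64 / 63 * bond_strength h f s b X.
Proof.
move=> vX; apply: expR_sub1_le => //.
apply: (@le_trans _ _ (64 * k%:R)^-1).
  apply: le_trans (strength_vertex v); rewrite (bigD1 X) //= lerDl sumr_ge0 //.
by rewrite invfM ler_piMr ?invr_ge0 // invf_le1 // ler1n.
Qed.

Let x_big (X : {set 'I_n}) : (k < #|X|)%N -> x X = 0.
Proof.
by move=> kX; rewrite /x /bond_strength h_small // f_small // !opnorm0 !mulr0 addr0 expR0 subrr.
Qed.

(** Bonds have at most [k] sites, so [K ^+ #|X| <= e^(14/8)]. The exponent is then at most
    [(64/63) e^(14/8) / (64 k)], which is at most [u] because [e^(14/8) <= (8/7)^14 <= 63/8]. *)
Let growth_vertex v E : growth x (expR (14 * u)) [set v] E <= expR u.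
Proof.
have e1 X : 1 + x X * expR (14 * u) ^+ #|X| <= expR (x X * expR (14 / 8)).
  apply: le_trans (expR_ge1Dx _); rewrite lerD2l.
  have [kX|Xk] := ltnP k #|X|; first by rewrite x_big // !mul0r.
  rewrite ler_wpM2l // -expRM_natl ler_expR mulrCA ler_wpM2l // card_u //.
apply: (@le_trans _ _ (\prod_(X : {set 'I_n} | v \in X) expR (x X * expR (14 / 8)))).
  rewrite /growth big_mkcond [leRHS]big_mkcond /=; apply: ler_prod => X _.
  have k0 : 0 <= expR (14 * u) by exact: expR_ge0.
  have := bond_factor_ge1 x_ge0 k0 X => g1.
  case: ifP => [/andP[_]|_].
    by rewrite disjoint_sym disjoints1 negbK => ->; rewrite e1 (le_trans ler01).
  by rewrite ler01 /=; case: ifP => // _; exact: le_trans (e1 X).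
rewrite -expR_sum ler_expR.
apply: (@le_trans _ _ (\sum_(X : {set 'I_n} | v \in X) (64 / 63 * expR (14 / 8)) * bond_strength h f s b X)).
  apply: ler_sum => X vX; rewrite mulrAC ler_wpM2r ?expR_ge0 //; exact: x_le vX.
rewrite -mulr_sumr.
have e0 : 0 <= 64 / 63 * expR (14 / 8) :> R by rewrite mulr_ge0 ?expR_ge0 // divr_ge0.
apply: le_trans (ler_wpM2l e0 (strength_vertex v)) _.
have h14 : expR (14 / 8) <= 63 / 8 :> R.
  by apply: le_trans (expR_eighths_le R 14) _; lra.
rewrite /u !invfM mulrA ler_pM2r ?invr_gt0 //; lra.
Qed.

Lemma gibbs_covariance X0 :
  \sum_Y normc (gibbs_expect h f s b (f X0 *m f Y) [set: {set 'I_n}] *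
      gibbs_expect h f s b 1%:M [set: {set 'I_n}] -
    gibbs_expect h f s b (f X0) [set: {set 'I_n}] * gibbs_expect h f s b (f Y) [set: {set 'I_n}]) <=
  opnorm (f X0) * (16 * g * k%:R) * normc (gibbs_expect h f s b 1%:M [set: {set 'I_n}]) ^+ 2.
Proof.
(* [2 * g] from the norms through one site, and [(A * B) ^+ #|Y| = e^(3u|Y|) <= e^(3/8)]. *)
pose m : R := 2 * g * expR (3 / 8).
have m0 : 0 <= m by rewrite !mulr_ge0 ?expR_ge0 ?ltW.
have exp3 (Y : {set 'I_n}) : (#|Y| <= k)%N -> expR (3 * u) ^+ #|Y| <= expR (3 / 8).
  by move=> Yk; rewrite -expRM_natl ler_expR; have := card_u Yk; lra.
have loc P S : supported_on S P ->
    local_observable x (gibbs_expect h f s b 1%:M) (gibbs_expect h f s b P) S (opnorm P).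
  exact: gibbs_expect_local.
have AB3 : expR (2 * u) * expR u = expR (3 * u) by rewrite -expRD; congr expR; ring.
have Z0loc : local_observable x (gibbs_expect h f s b 1%:M) (gibbs_expect h f s b 1%:M)
    finset.set0 1.
  have [H1 H2] := loc _ _ (@supported_on1 R n d finset.set0).
  split=> // C; apply: le_trans (H2 C) _.
  by rewrite ler_wpM2r ?opnorm1 // prodr_ge0.
have := covariance_bound x_ge0 (expR_ge0 (14 * u)) growth_vertex (A := expR (2 * u)) _ _ _ Z0loc
  (J := {set 'I_n}) (Zp := gibbs_expect h f s b (f X0)) (Zq := fun Y => gibbs_expect h f s b (f Y))
  (Zpq := fun Y => gibbs_expect h f s b (f X0 *m f Y)) (Sp := X0) (Sq := id)
  (cp := opnorm (f X0)) (m := m) (M := m * k%:R) (cq := fun Y => opnorm (f Y))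
  (opnorm_ge0 _) (fun Y => opnorm_ge0 _) (loc _ _ (f_supp X0)) (fun Y => loc _ _ (f_supp Y))
  _ _ _ _ _ _ (expR_ge0 _) [set: {set 'I_n}].
rewrite AB3 => H; apply: le_trans (H _ _ _ _ _ _ _ _ _) _; clear H.
- by rewrite -expR0 ler_expR mulr_ge0 ?ltW.
- have u8 : expR u <= 8 / 7.
    by apply: le_trans (expR_eighth_le R); rewrite ler_expR.
  have u1 : 1 <= expR u by rewrite -expR0 ler_expR ltW.
  rewrite expRM_natl.
  (* Rewritten so that [1 <= expR u <= 8 / 7] shows the product to be at least 1. *)
  have -> : expR u ^+ 2 * (2 - expR u) = 1 + (expR u - 1) * (1 - (expR u - 1) * expR u) by ring.
  have : (expR u - 1) * expR u <= (1 / 7) * (8 / 7) by apply: ler_pM; rewrite ?expR_ge0 //; lra.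
  by move=> hu; rewrite lerDl mulr_ge0 ?subr_ge0 //; lra.
- by rewrite ler_expR; apply: ler_wpM2r; [exact: ltW|rewrite ler_nat].
- move=> Y; have [H1 H2] := loc _ _ (supported_onM
    (supported_on_sub (finset.subsetUl X0 Y) (f_supp X0))
    (supported_on_sub (finset.subsetUr X0 Y) (f_supp Y))).
  split=> // C; apply: le_trans (H2 C) _.
  by rewrite ler_wpM2r ?opnormM // prodr_ge0.
- by move=> Y E1 E2; exact: gibbs_expect_split.
- by rewrite -expR0 ler_expR mulr_ge0 ?ltW.
- exact: mulr_ge0 m0 (ler0n _ _).
- move=> v.
  apply: (@le_trans _ _ (\sum_(Y : {set 'I_n} | v \in Y) (2 * expR (3 / 8)) * opnorm (f Y))).
    apply: ler_sum => Y _; have [kY|Yk] := ltnP k #|Y|.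
      by rewrite f_small // opnorm0 !mulr0 mul0r.
    rewrite mulrAC; apply: ler_wpM2r; first exact: opnorm_ge0.
    by apply: ler_wpM2l => //; exact: exp3.
  rewrite -big_distrr /= /m -[2 * g * _]mulrA [g * _]mulrC mulrA.
  by apply: ler_wpM2l (f_vertex v); rewrite mulr_ge0 ?expR_ge0.
- move=> X; apply: ler_wpM2l => //.
  rewrite -exprM -!expRM_natl.
  (* With [M = m * k], the linear factor is [1 + 8u|X| <= e^(8u|X|)]; together with
     [(A * B) ^+ 2 = e^(6u)] this gives the exponent 14 in [K]. *)
  have -> : m * #|X|%:R + m * k%:R = m * k%:R * (1 + #|X|%:R * (8 * u)).
    by rewrite /u; field; rewrite pnatr_eq0 -lt0n.
  rewrite mulrCA ler_wpM2l ?(mulr_ge0 m0) //.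
  apply: le_trans (ler_wpM2l (expR_ge0 _) (expR_ge1Dx _)) _.
  rewrite -expRD ler_expR natrM le_eqVlt; apply/orP; left; apply/eqP; ring.
have [kX|Xk] := ltnP k #|X0|; first by rewrite f_small // opnorm0 !mul0r.
set z2 := normc _ ^+ 2; have z2_ge0 : 0 <= z2 by exact: sqr_ge0.
rewrite -[leLHS]mulrA; rewrite [opnorm _ * _ * z2]mulrAC; apply: ler_wpM2l.
  exact: mulr_ge0 (opnorm_ge0 _) z2_ge0.
have e6 : (expR (3 * u) ^+ 2) ^+ #|X0| <= expR (6 / 8).
  rewrite -exprM -expRM_natl ler_expR natrM.
  have := card_u Xk; lra.
(* [(8/7)^9 <= 4], so the constant is at most [4 * 4 * g * k]. *)
have e9 : expR (6 / 8) * expR (3 / 8) <= 4 :> R.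
  rewrite -expRD (_ : 6 / 8 + 3 / 8 = 9%:R / 8); last by field.
  by apply: le_trans (expR_eighths_le R 9) _; lra.
have mX : m * #|X0|%:R + m * k%:R <= 4 * g * k%:R * expR (3 / 8).
  have : m * #|X0|%:R <= m * k%:R by rewrite ler_wpM2l // ler_nat.
  rewrite /m; lra.
have mX0 : 0 <= m * #|X0|%:R + m * k%:R
  by exact: addr_ge0 (mulr_ge0 m0 (ler0n _ _)) (mulr_ge0 m0 (ler0n _ _)).
apply: le_trans (ler_pM _ mX0 e6 mX) _; first by do 2!apply: exprn_ge0; exact: expR_ge0.
rewrite [leLHS](_ : _ = (4 * g * k%:R) * (expR (6 / 8) * expR (3 / 8))); last by ring.
apply: le_trans (ler_wpM2l _ e9) _; first by exact: mulr_ge0 (mulr_ge0 (ler0n _ 4) (ltW g_gt0)) (ler0n _ _).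
by rewrite le_eqVlt; apply/orP; left; apply/eqP; ring.
Qed.

End GibbsCovariance.

(** * Taylor bound for the log-partition function *)

Section TraceOfExponentials.
Context (R : realType) (m : nat).
Implicit Types (A U V : 'M[R[i]]_m) (a c d : 'I_m -> R).
Local Notation normc := (@Normc.normc R).

(** The weights are squared overlaps of the two eigenbases, hence nonnegative; this makes the trace
    of two noncommuting exponentials a positive sum of real exponentials. *)
Lemma mxtrace_diagonalized U V a c :
  \tr (adjmx U *m rdiag a *m U *m (adjmx V *m rdiag c *m V)) =
  real_complex R (\sum_j a j * \sum_l normc ((U *m adjmx V) j l) ^+ 2 * c l).
Proof.
set W := U *m adjmx V.
have WE : V *m adjmx U = adjmx W.
  rewrite /adjmx /W trmx_mul map_mxM; congr (_ *m _).
  by apply/matrixP => i j; rewrite !mxE; exact: esym (conjcK _).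
have -> : adjmx U *m rdiag a *m U *m (adjmx V *m rdiag c *m V) =
    adjmx U *m (rdiag a *m W *m rdiag c *m V) by rewrite /W !mulmxA.
clearbody W; rewrite mxtrace_mulC -[_ *m V *m _]mulmxA WE -!mulmxA /mxtrace rmorph_sum /=; apply: eq_bigr => j _.
rewrite mul_diag_mx mxE mxE rmorphM; congr (_ * _).
rewrite mxE rmorph_sum; apply: eq_bigr => l _.
rewrite /rdiag mul_diag_mx !mxE rmorphM. rewrite mulrCA mulrC; congr (_ * _).
rewrite rmorphXn /=; have := sqr_normc (W j l); rewrite normc_def => <-.
by congr (_ ^+ 2); case: (W j l).
Qed.

Lemma diagonalizes_mul U a c : unitary_mx U ->
  (adjmx U *m rdiag a *m U) *m (adjmx U *m rdiag c *m U) =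
  adjmx U *m rdiag (fun j => a j * c j) *m U.
Proof.
move=> Uu; rewrite !mulmxA -[_ *m U *m adjmx U]mulmxA Uu mulmx1.
congr (_ *m U); rewrite -mulmxA; congr (_ *m _).
rewrite mulmx_diag; congr diag_mx; apply/matrixP => i j.
by rewrite !mxE rmorphM.
Qed.

Lemma diagonalizes_cst1 U : unitary_mx U -> adjmx U *m rdiag (fun=> 1) *m U = 1%:M.
Proof.
move=> Uu; rewrite -(unitary_mxV Uu); congr (_ *m U).
rewrite -[RHS]mulmx1; congr (_ *m _); apply/matrixP => i j.
by rewrite !mxE rmorph1.
Qed.

End TraceOfExponentials.

(** * Logarithm of a positive sum of exponentials *)

Section LogSumExp.
Context (R : realType) (m : nat).
Implicit Types (p d : 'I_m -> R) (r t s C : R).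
Local Open Scope classical_set_scope.

(** The [l]-th derivative of [\sum_j p j * expR (s * d j)]. *)
Definition exp_moment p d (l : nat) s : R := \sum_j d j ^+ l * expR (s * d j) * p j.

Lemma is_derive_mulc (c s : R) : is_derive s 1 (fun r : R => c * r) c.
Proof. by have := is_deriveZ c (is_derive_id s (1 : R)); rewrite [_ *: _]mulr1. Qed.

Lemma is_derive_exp_moment p d l s :
  is_derive s 1 (exp_moment p d l) (exp_moment p d l.+1 s).
Proof.
have -> : exp_moment p d l = \sum_j (fun s => d j ^+ l * expR (s * d j) * p j).
  by apply/funext => r; rewrite fct_sumE.
apply: is_derive_sum => j.
have ex := is_derive1_comp (is_derive_expR (d j * s)) (is_derive_mulc (d j) s).
have exZ : is_derive s 1 (fun r : R => d j ^+ l * p j * expR (d j * r))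
    (d j ^+ l * p j * (expR (d j * s) * d j)) := is_deriveZ (d j ^+ l * p j) ex.
have -> : (fun r : R => d j ^+ l * expR (r * d j) * p j) =
    fun r : R => d j ^+ l * p j * expR (d j * r).
  by apply/funext => r; rewrite [d j * r]mulrC mulrAC.
have -> : d j ^+ l.+1 * expR (s * d j) * p j = d j ^+ l * p j * (expR (d j * s) * d j).
  by rewrite [d j * s]mulrC exprS; ring.
exact: exZ.
Qed.

Lemma nonincreasing_is_derive (f df : R -> R) t : 0 <= t ->
  (forall s, is_derive s 1 f (df s)) -> (forall s, 0 <= s <= t -> df s <= 0) -> f t <= f 0.
Proof.
move=> t0 fdf df0.
have der s : derivable f s 1 by have [] := fdf s.
apply: (@ler0_derive1_nincr _ f 0 t) => //.
- move=> s; rewrite in_itv /= => /andP[s0 st].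
  by rewrite derive1E (@derive_val _ _ _ _ _ _ _ (fdf s)) df0 // !ltW.
- by apply: derivable_within_continuous => s _.
Qed.


Lemma exp_moment0_gt0 p d s : (forall j, 0 <= p j) -> 0 < \sum_j p j -> 0 < exp_moment p d 0 s.
Proof.
move=> p0 sp; rewrite lt0r; apply/andP; split; last first.
  by apply: sumr_ge0 => j _; rewrite expr0 mul1r mulr_ge0 ?expR_ge0.
apply: contraTneq sp => /eqP; rewrite psumr_eq0 => [/allP all0|j _]; last first.
  by rewrite expr0 mul1r mulr_ge0 ?expR_ge0.
rewrite big1 ?ltxx // => j _; have := all0 j (mem_index_enum j).
by rewrite expr0 mul1r mulf_eq0 gt_eqF ?expR_gt0 //= => /eqP.
Qed.

(** Taylor's bound by two monotonicity arguments: [D] is the derivative of [ln Z] minus that of the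
    claimed bound; it vanishes at 0 and decreases, so [G] decreases too. *)
Lemma ln_exp_moment_le p d C t : (forall j, 0 <= p j) -> 0 < \sum_j p j -> 0 <= t ->
  (forall s, 0 <= s <= t -> exp_moment p d 2 s * exp_moment p d 0 s - exp_moment p d 1 s ^+ 2
     <= C * exp_moment p d 0 s ^+ 2) ->
  ln (exp_moment p d 0 t) <= ln (exp_moment p d 0 0) +
    t * (exp_moment p d 1 0 / exp_moment p d 0 0) + C / 2 * t ^+ 2.
Proof.
move=> p0 sp t0 var.
have Zgt0 s := exp_moment0_gt0 d s p0 sp.
set Z := exp_moment p d 0 in Zgt0 var *; set Z1 := exp_moment p d 1 in var *.
set Z2 := exp_moment p d 2 in var.
pose q := Z1 0 / Z 0.
pose D s := Z1 s / Z s - q - C * s.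
have dZ s : is_derive s 1 Z (Z1 s) by exact: is_derive_exp_moment.
have dZ1 s : is_derive s 1 Z1 (Z2 s) by exact: is_derive_exp_moment.
have dD s : is_derive s 1 D ((Z2 s * Z s - Z1 s ^+ 2) / Z s ^+ 2 - C).
  have Zn0 : Z s != 0 by rewrite gt_eqF.
  have dV := is_deriveV Zn0 (dZ s).
  have dB : is_derive s 1 D (Z1 s * (- Z s ^- 2 * Z1 s) + (Z s)^-1 * Z2 s - 0 - C) :=
    is_deriveB (is_deriveB (is_deriveM (dZ1 s) dV) (is_derive_cst q s (1 : R)))
      (is_derive_mulc C s).
  apply: is_derive_eq dB _; field; exact: Zn0.
have D_le0 s : 0 <= s <= t -> D s <= 0.
  move=> /andP[s0 st]; have D0 : D 0 = 0 by rewrite /D /q mulr0 subr0 subrr.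
  rewrite -D0; apply: (nonincreasing_is_derive s0 dD) => r /andP[r0 rs].
  rewrite subr_le0 ler_pdivrMr ?exprn_gt0 //; apply: var.
  by rewrite r0 (le_trans rs).
pose G s := ln (Z s) - q * s - C / 2 * s ^+ 2.
have dG s : is_derive s 1 G (D s).
  have dln := is_derive1_comp (is_derive1_ln (Zgt0 s)) (dZ s).
  have dsq := is_deriveZ (C / 2) (is_deriveX 2 (is_derive_id s (1 : R))).
  have dB : is_derive s 1 G ((Z s)^-1 * Z1 s - q - C / 2 * (2%:R * s ^+ 1 * 1)) :=
    is_deriveB (is_deriveB dln (is_derive_mulc q s)) dsq.
  by apply: is_derive_eq dB _; rewrite /D; field; rewrite gt_eqF.
have := nonincreasing_is_derive t0 dG D_le0.
rewrite /G expr0n /= !mulr0 !subr0 -/q; lra.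
Qed.

(** A negative [t] is reflected by changing the sign of every [d j]. *)
Lemma ln_exp_moment_le_sym p d C t : (forall j, 0 <= p j) -> 0 < \sum_j p j ->
  (forall s, `|s| <= `|t| -> exp_moment p d 2 s * exp_moment p d 0 s - exp_moment p d 1 s ^+ 2
     <= C * exp_moment p d 0 s ^+ 2) ->
  ln (exp_moment p d 0 t) <= ln (exp_moment p d 0 0) +
    t * (exp_moment p d 1 0 / exp_moment p d 0 0) + C / 2 * t ^+ 2.
Proof.
move=> p0 sp var; have [t0|t0] := leP 0 t.
  by apply: ln_exp_moment_le => // s /andP[s0 st]; apply: var; rewrite !ger0_norm.
have flip l s : exp_moment p (fun j => - d j) l s = (-1) ^+ l * exp_moment p d l (- s).
  rewrite /exp_moment mulr_sumr; apply: eq_bigr => j _.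
  by rewrite mulrN -mulNr -[- d j]mulN1r exprMn -!mulrA.
have nt0 : 0 <= - t by rewrite oppr_ge0 ltW.
have := @ln_exp_moment_le p (fun j => - d j) C (- t) p0 sp nt0.
rewrite !flip !expr0 !mul1r expr1 opprK oppr0 sqrrN => H.
have {H} := H _; set P := (X in (X -> _) -> _) => H.
have HP : P.
  move=> s /andP[s0 st]; rewrite !flip expr0 mul1r expr1 sqrrN expr1n mul1r mulN1r sqrrN.
  by apply: var; rewrite normrN ger0_norm // ltr0_norm.
apply: le_trans (H HP) _; rewrite le_eqVlt; apply/orP; left; apply/eqP; ring.
Qed.

End LogSumExp.

(** * Second-order bound for the perturbed partition function *)

Section GibbsBound.
Context (R : realType) (n d k : nat) (g s b : R) (h f : {set 'I_n} -> qop R n d).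
Hypotheses (d_gt0 : (0 < d)%N) (k_gt0 : (0 < k)%N) (g_gt0 : 0 < g).
Hypotheses (h_herm : forall X, is_hermitian_op (h X)) (f_herm : forall X, is_hermitian_op (f X)).
Hypotheses (h_supp : forall X, supported_on X (h X)) (f_supp : forall X, supported_on X (f X)).
Hypotheses (h_small : forall X : {set 'I_n}, (k < #|X|)%N -> h X = 0).
Hypotheses (f_small : forall X : {set 'I_n}, (k < #|X|)%N -> f X = 0).
Hypothesis h_vertex : forall v, \sum_(X : {set 'I_n} | v \in X) opnorm (h X) <= g.
Hypothesis f_vertex : forall v, \sum_(X : {set 'I_n} | v \in X) opnorm (f X) <= g.
Hypothesis small : (`|s| + `|b|) * g * k%:R <= 64^-1.
Local Notation normc := (@Normc.normc R).
Local Notation F := (bond_sum f [set: {set 'I_n}]).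
Local Notation H := (bond_sum h [set: {set 'I_n}]).

(** The smallness condition persists for [|r| <= |s|], so one constant serves along the whole path
    from 0 to [s]. Expanding both factors [F] leaves covariances, bounded for each fixed [X]. *)
Lemma gibbs_variance r : `|r| <= `|s| ->
  normc (gibbs_expect h f r b (F *m F) [set: {set 'I_n}] *
         gibbs_expect h f r b 1%:M [set: {set 'I_n}] -
         gibbs_expect h f r b F [set: {set 'I_n}] ^+ 2) <=
  (16 * g * k%:R * \sum_X opnorm (f X)) *
    normc (gibbs_expect h f r b 1%:M [set: {set 'I_n}]) ^+ 2.
Proof.
move=> rs.
have small_r : (`|r| + `|b|) * g * k%:R <= 64^-1.
  apply: le_trans small; rewrite -!mulrA; apply: ler_wpM2r; last by rewrite lerD2r.
  exact: mulr_ge0 (ltW g_gt0) (ler0n _ _).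
have FE : F = \sum_X f X by rewrite /bond_sum; apply: eq_bigl => X; rewrite inE.
set E := [set: {set 'I_n}]; set e := gibbs_expect h f r b.
have e_sum (a : {set 'I_n} -> qop R n d) : e (\sum_X a X) E = \sum_X e (a X) E.
  by rewrite /e /gibbs_expect mulmx_suml raddf_sum mulr_sumr.
have -> : e (F *m F) E * e 1%:M E - e F E ^+ 2 =
    \sum_X \sum_Y (e (f X *m f Y) E * e 1%:M E - e (f X) E * e (f Y) E).
  have -> : e (F *m F) E = \sum_X \sum_Y e (f X *m f Y) E.
    by rewrite FE mulmx_suml e_sum; apply: eq_bigr => X _; rewrite mulmx_sumr e_sum.
  rewrite FE e_sum expr2 !mulr_suml -sumrB; apply: eq_bigr => X _.
  by rewrite mulr_suml mulr_sumr -sumrB.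
apply: le_trans (ler_normc_sum _ _ _) _.
rewrite [16 * g * k%:R * _]mulrC mulr_suml mulr_suml; apply: ler_sum => X _.
apply: le_trans (ler_normc_sum _ _ _) _.
exact: (gibbs_covariance d_gt0 k_gt0 g_gt0 h_herm f_herm h_supp f_supp h_small f_small
  h_vertex f_vertex small_r X).
Qed.

Lemma ln_gibbs_le :
  ln (complex.Re (\tr (mexp (real_complex R s *: F) *m
     ((\tr (mexp (real_complex R b *: H)))^-1 *: mexp (real_complex R b *: H))))) <=
  s * complex.Re (\tr (F *m
     ((\tr (mexp (real_complex R b *: H)))^-1 *: mexp (real_complex R b *: H)))) +
  8 * g * k%:R * (\sum_X opnorm (f X)) * s ^+ 2.
Proof.
have [U [a Ua]] := hermitian_diagonalizable (bond_sum_hermitian [set: {set 'I_n}] f_herm).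
have [V [c Vc]] := hermitian_diagonalizable (bond_sum_hermitian [set: {set 'I_n}] h_herm).
have Uu : unitary_mx U by case: Ua.
have EE := mexp_diagonalizes (diagonalizesZ b Vc).
set E := mexp (real_complex R b *: H) in EE *.
(* Diagonal entry of [E] in the eigenvector of [F] with eigenvalue [a j]. *)
pose p j := \sum_l normc ((U *m adjmx V) j l) ^+ 2 * expR (b * c l).
have p_ge0 j : 0 <= p j.
  by apply: sumr_ge0 => l _; exact: mulr_ge0 (sqr_ge0 _) (expR_ge0 _).
have trE q : \tr (adjmx U *m rdiag q *m U *m E) = real_complex R (\sum_j q j * p j).
  by rewrite EE mxtrace_diagonalized.
have mexpF r : mexp (real_complex R r *: F) = adjmx U *m rdiag (fun j => expR (r * a j)) *m U.
  exact: mexp_diagonalizes (diagonalizesZ r Ua).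
have FE : F = adjmx U *m rdiag a *m U by case: Ua.
have tr1 : \tr E = real_complex R (\sum_j p j).
  rewrite -[E in LHS]mul1mx -(diagonalizes_cst1 Uu) trE; congr (real_complex R _).
  by apply: eq_bigr => j _; rewrite mul1r.
have sp : 0 < \sum_j p j.
  (* In the eigenbasis of [H] the trace is a sum of exponentials, nonempty because the dimension is
     positive. *)
  have : \tr E = real_complex R (\sum_l expR (b * c l)).
    have Vu : unitary_mx V by case: Vc.
    rewrite EE mxtrace_mulC mulmxA Vu mul1mx /mxtrace rmorph_sum.
    by apply: eq_bigr => l _; rewrite !mxE eqxx.
  rewrite tr1 => /complexI ->.
  rewrite (bigD1 (Ordinal (hdim_gt0 n d_gt0))) //= ltr_pwDl ?expR_gt0 //.
  by apply: sumr_ge0 => l _; exact: expR_ge0.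
have M0 r : \tr (mexp (real_complex R r *: F) *m E) = real_complex R (exp_moment p a 0 r).
  rewrite mexpF trE /exp_moment; congr (real_complex R _); apply: eq_bigr => j _.
  by rewrite expr0 mul1r.
have M1 r : \tr (F *m (mexp (real_complex R r *: F) *m E)) = real_complex R (exp_moment p a 1 r).
  rewrite mulmxA mexpF {1}FE diagonalizes_mul // trE /exp_moment.
have M2 r : \tr (F *m F *m (mexp (real_complex R r *: F) *m E)) =
    real_complex R (exp_moment p a 2 r).
  rewrite mulmxA mexpF {1 2}FE !diagonalizes_mul // trE /exp_moment.
have m00 : exp_moment p a 0 0 = \sum_j p j.
  by apply: eq_bigr => j _; rewrite expr0 mul0r expR0 !mul1r.
have D0 : 0 < (hdim n d)%:R^-1 :> R by rewrite invr_gt0 ltr0n hdim_gt0.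
have DC : (hdim n d)%:R^-1 = real_complex R (hdim n d)%:R^-1 by rewrite fmorphV rmorph_nat.
have var r : `|r| <= `|s| -> exp_moment p a 2 r * exp_moment p a 0 r - exp_moment p a 1 r ^+ 2 <=
    (16 * g * k%:R * \sum_X opnorm (f X)) * exp_moment p a 0 r ^+ 2.
  move=> rs; have := gibbs_variance rs.
  rewrite /gibbs_expect /gibbs /bond_exp -/E !mul1mx M0 M1 M2 DC.
  rewrite -!rmorphM -rmorphXn -rmorphB !normc_real.
  set D := (hdim n d)%:R^-1; set m0 := exp_moment p a 0 r; set m1 := exp_moment p a 1 r.
  set m2 := exp_moment p a 2 r; set B := 16 * g * k%:R * _ => le_var.
  (* The normalisation enters both sides as [D ^+ 2] and cancels. *)
  have D2 : 0 < D ^+ 2 by rewrite exprn_gt0.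
  rewrite -(ler_pM2l D2); apply: (@le_trans _ _ `|D * m2 * (D * m0) - (D * m1) ^+ 2|).
    apply: le_trans (ler_norm _); rewrite le_eqVlt; apply/orP; left; apply/eqP; ring.
  apply: le_trans le_var _; rewrite real_normK ?num_real //.
  by rewrite le_eqVlt; apply/orP; left; apply/eqP; ring.
have := ln_exp_moment_le_sym p_ge0 sp var.
rewrite -!scalemxAr !mxtraceZ M0 tr1.
have F1 : \tr (F *m E) = real_complex R (exp_moment p a 1 0).
  have := M1 0; rewrite mexpF (_ : (fun j => expR (0 * a j)) = fun=> 1).
    by rewrite diagonalizes_cst1 // mul1mx.
  by apply/funext => j; rewrite mul0r expR0.
rewrite F1 -m00 -fmorphV -!rmorphM /=.
have z0 : 0 < exp_moment p a 0 0 by rewrite m00.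
rewrite lnM ?posrE ?invr_gt0 ?(exp_moment0_gt0 _ _ p_ge0 sp) // lnV ?posrE //.
set L0 := ln (exp_moment p a 0 0); set Ls := ln _; set q := exp_moment p a 1 0.
rewrite [_ / _ in X in X -> _]mulrC; lra.
Qed.

End GibbsBound.

Theorem theorem1 (R : realType) (n d k : nat) (g beta tau : R)
  (h f : {set 'I_n} -> qop R n d) :
  (0 < d)%N -> (1 <= k)%N -> 0 < g ->
  (forall X : {set 'I_n}, (#|X| <= k)%N -> is_hermitian_op (h X) /\ supported_on X (h X)) ->
  (forall X : {set 'I_n}, (#|X| <= k)%N -> is_hermitian_op (f X) /\ supported_on X (f X)) ->
  (forall v : 'I_n, \sum_(X : {set 'I_n} | (#|X| <= k)%N && (v \in X)) opnorm (h X) <= g) ->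
  (forall v : 'I_n, \sum_(X : {set 'I_n} | (#|X| <= k)%N && (v \in X)) opnorm (f X) <= g) ->
  0 <= beta -> beta < betac g k -> `|tau| < betac g k - beta ->
  let H := \sum_(X : {set 'I_n} | (#|X| <= k)%N) h X in
  let F := \sum_(X : {set 'I_n} | (#|X| <= k)%N) f X in
  let Fbar := \sum_(X : {set 'I_n} | (#|X| <= k)%N) opnorm (f X) in
  let E := mexp (real_complex R (- beta) *: H) in
  let rho := (\tr E)^-1 *: E in
  ln (complex.Re (\tr (mexp (real_complex R (- tau) *: F) *m rho)))
    <= - tau * complex.Re (\tr (F *m rho))
       + tau ^+ 2 * Fbar / (betac g k - beta - `|tau|).
Proof.
move=> d_gt0 k_gt0 g_gt0 hP fP h_vertex f_vertex beta0 _ tau_lt; cbv zeta.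
set H := \sum_(X | _) h X; set F := \sum_(X | _) f X; set Fbar := \sum_(X | _) opnorm _.
set E := mexp (_ *: H); set rho := _ *: E.
(* Terms on more than [k] sites are replaced by 0, so that sums run over all sets. *)
pose trunc (a : {set 'I_n} -> qop R n d) (X : {set 'I_n}) := if (#|X| <= k)%N then a X else 0.
have trunc_herm (a : {set 'I_n} -> qop R n d) :
    (forall X : {set 'I_n}, (#|X| <= k)%N -> is_hermitian_op (a X) /\ supported_on X (a X)) ->
    forall X, is_hermitian_op (trunc a X).
  move=> aP X; rewrite /trunc; case: leqP => [/aP[]//|_].
  by apply/matrixP => i j; rewrite !mxE rmorph0.
have trunc_supp (a : {set 'I_n} -> qop R n d) :
    (forall X : {set 'I_n}, (#|X| <= k)%N -> is_hermitian_op (a X) /\ supported_on X (a X)) ->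
    forall X, supported_on X (trunc a X).
  by move=> aP X; rewrite /trunc; case: leqP => [/aP[]//|_]; exact: supported_on0.
have trunc_small a (X : {set 'I_n}) : (k < #|X|)%N -> trunc a X = 0.
  by rewrite /trunc ltnNge => /negbTE ->.
have trunc_norm a (X : {set 'I_n}) :
    opnorm (trunc a X) = if (#|X| <= k)%N then opnorm (a X) else 0.
  by rewrite /trunc; case: ifP => // _; exact: opnorm0.
have trunc_vertex (a : {set 'I_n} -> qop R n d) :
    (forall v : 'I_n, \sum_(X : {set 'I_n} | (#|X| <= k)%N && (v \in X)) opnorm (a X) <= g) ->
    forall v, \sum_(X : {set 'I_n} | v \in X) opnorm (trunc a X) <= g.
  move=> av v; rewrite (eq_bigr _ (fun X _ => trunc_norm a X)) -big_mkcondr.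
  rewrite (eq_bigl (fun X : {set 'I_n} => (#|X| <= k)%N && (v \in X))); first exact: av.
  by move=> X; rewrite andbC.
have trunc_sum (a : {set 'I_n} -> qop R n d) : \sum_(X : {set 'I_n} | (#|X| <= k)%N) a X =
    bond_sum (trunc a) [set: {set 'I_n}].
  by rewrite /bond_sum big_mkcond; apply: eq_bigl => X; rewrite inE.
set c := betac g k.
have gk : 0 < g * k%:R by rewrite mulr_gt0 // ltr0n.
have c_gt0 : 0 < c by rewrite invr_gt0 -mulrA mulr_gt0 // mulr_gt0 // exprn_gt0 // expR_gt0.
have cE : c * (g * k%:R) = (8 * expR 1 ^+ 3)^-1.
  by rewrite /c /betac; field; rewrite !gt_eqF ?expR_gt0 // ltr0n.
have e2 : 2 <= expR 1 :> R by have := expR_ge1Dx (1 : R); lra.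
(* This puts [c * g * k = 1 / (8 e^3)] below [1 / 64], the smallness required by the expansion. *)
have e8 : 8 <= expR 1 ^+ 3 :> R.
  have -> : 8 = 2 ^+ 3 :> R by ring.
  by apply: lerXn2r; rewrite ?nnegrE ?expR_ge0.
have small : (`|- tau| + `|- beta|) * g * k%:R <= 64^-1.
  rewrite !normrN (ger0_norm beta0) -mulrA.
  apply: (@le_trans _ _ (c * (g * k%:R))).
    by apply: ler_wpM2r; [exact: ltW|move: tau_lt; rewrite -/c; lra].
  by rewrite cE lef_pV2 ?posrE //; lra.
(* Applied with [s = - tau] and [b = - beta]. *)
have := ln_gibbs_le d_gt0 k_gt0 g_gt0 (trunc_herm h hP) (trunc_herm f fP)
  (trunc_supp h hP) (trunc_supp f fP) (trunc_small h) (trunc_small f)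
  (trunc_vertex h h_vertex) (trunc_vertex f f_vertex) small.
rewrite -!trunc_sum -/H -/F -/E -/rho => bound; apply: le_trans bound _.
have -> : \sum_X opnorm (trunc f X) = Fbar.
  by rewrite /Fbar [RHS]big_mkcond; apply: eq_bigr => X _; rewrite trunc_norm.
have Fbar_ge0 : 0 <= Fbar by apply: sumr_ge0 => X _; exact: opnorm_ge0.
rewrite lerD2l sqrrN -mulrA mulrC -mulrA.
rewrite [Fbar * _]mulrC; apply: ler_wpM2l; first exact: mulr_ge0 (sqr_ge0 _) Fbar_ge0.
set e := c - beta - `|tau|.
have e_gt0 : 0 < e by move: tau_lt; rewrite -/c /e; lra.
have e_le : e <= c by have := normr_ge0 tau; rewrite /e; lra.
(* It remains to see [8 * g * k * e <= 1], which follows from [e <= c] and [c * g * k <= 1 / 64]. *)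
rewrite -[leRHS]mul1r ler_pdivlMr // -mulrA.
have : (g * k%:R) * e <= (8 * expR 1 ^+ 3)^-1.
  by rewrite -cE mulrC; apply: ler_wpM2r => //; exact: ltW.
have : (8 * expR 1 ^+ 3)^-1 <= 64^-1 :> R by rewrite lef_pV2 ?posrE //; lra.
lra.
Qed.
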